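(* Let $d\in\mathbb{N}$, $d\geq2$ and $f\colon\mathbb{Z}^{d}\to\mathbb{R}^{d}$ be a bilipschitz mapping. Then the following are equivalent: (i) There exists a bilipschitz mapping $F\colon \mathbb{R}^{d}\to \mathbb{R}^{d}$ such that $F|_{\mathbb{Z}^{d}}=f$. (ii) There exist $T\in\mathbb{N}$ and a bilipschitz mapping $G\colon \mathbb{R}^{d}\to\mathbb{R}^{d}$ such that the mapping \[\widetilde{F}\colon \mathbb{Z}^{d}\cup \big(\mathbb{R}^{d-1}\times(T\mathbb{Z}+\tfrac{1}{2})\big)\to \mathbb{R}^{d},\qquad \widetilde{F}(x)=\begin{cases} f(x) & x\in\mathbb{Z}^{d},\\ G(x) & x\in \mathbb{R}^{d-1}\times(T\mathbb{Z}+\frac{1}{2}),\end{cases}\] is bilipschitz and for every $k\in\mathbb{Z}$, \[f\Big(\mathbb{Z}^d\cap \big(\mathbb{R}^{d-1}\times[(k-1)T+\tfrac{1}{2},kT+\tfrac{1}{2}]\big)\Big)\subseteq G\Big(\mathbb{R}^{d-1}\times[(k-1)T+\tfrac{1}{2},kT+\tfrac{1}{2}]\Big).\] Furthermore, there is a monotone increasing function $\beta_{d}\colon [1,\infty)\to [1,\infty)$ with $2\lfloor t\rfloor-1\leq\beta_{d}(t)\leq 2^{8dt}$ for all $t\in [1,\infty)$ such that whenever (ii) holds with $M_{1}\geq \operatorname{bilip}(\widetilde{F})$ and $M_{2}\geq \operatorname{bilip}(G)$, the bilipschitz extension $F$ of $f$ in (i) may be found with \[\operatorname{bilip}(F)\leq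 \beta_{d}\Big(2^{42}d^{9/2}(M_{1}M_{2})^{10}T^{3+\frac{3}{d-1}}\Big)^{3^{d-1}+1}.\] Moreover, $\beta_d$ may be taken to be the function $\beta_d$ defined in the context below.
   Context: For a mapping $f$, $\operatorname{Lip}(f)=\sup_{x\neq y}\|f(y)-f(x)\|/\|y-x\|$ (Euclidean norm); for injective $f$, $\operatorname{bilip}(f)=\max\{\operatorname{Lip}(f),\operatorname{Lip}(f^{-1})\}$; $f$ is $L$-bilipschitz if $\operatorname{bilip}(f)\le L$ and bilipschitz if this holds for some finite $L$. Definition of $\beta_d$: let $\mathcal{F}_d$ be the collection of all monotone increasing functions $\psi\colon[1,\infty)\to[1,\infty)$ such that the following holds: for every $S\in\mathbb{N}$, with $Q:=(-\frac12,\dots,-\frac12)+[0,S]^{d-1}\subseteq\mathbb{R}^{d-1}$, and every permutation $\sigma\colon\mathbb{Z}^{d-1}\to\mathbb{Z}^{d-1}$ such that for each $z\in\mathbb{Z}^{d-1}$ the restriction of $\sigma$ to $\mathbb{Z}^{d-1}\cap(Q+Sz)$ is a permutation of $\mathbb{Z}^{d-1}\cap(Q+Sz)$, there is a $\psi(S)$-bilipschitz mapping $\Upsilon\colon\mathbb{R}^d\to\mathbb{R}^d$ with $\Upsilon(x)=x$ for all $x\in\mathbb{R}^{d-1}\times(\mathbb{R}\setminus(-\frac12,\frac12))$ and $\Upsilon(x,0)=(\sigma(x),0)$ for all $x\in\mathbb{Z}^{d-1}$. Then $\beta_d$ is the pointwise infimum of $\mathcal{F}_d$. *)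

(* Defs.v *)
From HB Require Import structures.
From mathcomp Require Import all_boot all_order all_algebra.
From mathcomp Require Import boolp classical_sets reals exp.
Set Implicit Arguments. Unset Strict Implicit. Unset Printing Implicit Defensive.
Import Order.TTheory GRing.Theory Num.Theory.
Local Open Scope classical_set_scope.
Local Open Scope ring_scope.

Section Defs.
Variable R : realType.

Definition pt (n : nat) := 'I_n -> R.

Definition edist n (x y : pt n) : R := Num.sqrt (\sum_(i < n) (y i - x i) ^+ 2).

Definition emb n (z : 'I_n -> int) : pt n := fun i => (z i)%:~R.

Definition lastc d : pt d -> R :=
  match d as m return pt m -> R with
  | 0 => fun _ => 0
  | m.+1 => fun x => x ord_max
  end.

Definition ext0 d (y : pt d.-1) : pt d :=
  fun i => match (insub (val i) : option 'I_d.-1) with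
           | Some j => y j
           | None => 0
           end.

Definition bilip_on n (A : set (pt n)) (g : pt n -> pt n) (L : R) : Prop :=
  forall x y, A x -> A y -> x <> y ->
    edist (g x) (g y) <= L * edist x y /\ edist x y <= L * edist (g x) (g y).

Definition bilip_lat n (f : ('I_n -> int) -> pt n) (L : R) : Prop :=
  forall z w, z <> w ->
    edist (f z) (f w) <= L * edist (emb z) (emb w) /\
    edist (emb z) (emb w) <= L * edist (f z) (f w).

Definition lattice n : set (pt n) := [set x | exists z, x = emb z].

Definition hyperplanes d (T : nat) : set (pt d) :=
  [set x | exists k : int, lastc x = k%:~R * T%:R + 2^-1].

Definition slab d (T : nat) (k : int) : set (pt d) :=
  [set x | (k - 1)%:~R * T%:R + 2^-1 <= lastc x <= k%:~R * T%:R + 2^-1].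

Definition Ftilde d (f : ('I_d -> int) -> pt d) (G : pt d -> pt d) (x : pt d) : pt d :=
  if `[< lattice x >] then f (fun i => Num.floor (x i)) else G x.

Definition Ftilde_dom d (T : nat) : set (pt d) := @lattice d `|` @hyperplanes d T.

Definition block m (S : nat) (z : 'I_m -> int) : set (pt m) :=
  [set y | forall i, - 2^-1 + S%:R * (z i)%:~R <= y i <= - 2^-1 + S%:R * (z i)%:~R + S%:R].

Definition F_class d : set (R -> R) :=
  [set psi |
     (forall t, 1 <= t -> 1 <= psi t) /\
     (forall s t, 1 <= s -> s <= t -> psi s <= psi t) /\
     (forall (S : nat) (sigma : ('I_d.-1 -> int) -> ('I_d.-1 -> int)),
        (1 <= S)%N ->
        bijective sigma ->
        (forall z y, block S z (emb y) -> block S z (emb (sigma y))) ->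
        (forall z y', block S z (emb y') -> exists y, block S z (emb y) /\ sigma y = y') ->
        exists Ups : pt d -> pt d,
          bilip_on setT Ups (psi S%:R) /\
          (forall x, ~ (- 2^-1 < lastc x < 2^-1) -> Ups x = x) /\
          (forall y, Ups (ext0 (emb y)) = ext0 (emb (sigma y))))].

Definition beta d (t : R) : R := inf [set psi t | psi in F_class d].

End Defs.

Arguments emb {R n} z _.
Arguments lattice {R} n _.
Arguments hyperplanes {R} d T _.
Arguments slab {R} d T k _.
Arguments Ftilde_dom {R} d T _.
Arguments beta {R} d t.
Arguments F_class {R} d _.

(* Main.v *)
(* A polynomial bound is available, so the maps defining beta_d are not needed:
   only the lower bound beta_d(t) >= 2 floor(t) - 1 >= t enters the estimate.

   Extension in one slab.  Put q_z := G^-1(f z).  It is a separated family,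
   staying away from the boundary of the slab of z, and q_z is at distance at
   most 2 M1 M2 T from z.  A map which is the identity outside the slab and sends
   z to q_z is a composition of four explicit maps:
   (1) small disjoint pushes change the height of z so that any two points with
       the same height are very far apart;
   (2) at these heights every point is moved horizontally, independently of the
       others, above or below (a small perturbation of) q_z;
   (3) the perturbations are chosen so that the vertical lines through them are
       separated, and a fibrewise map moves each point along its line to the
       height of q_z;
   (4) small disjoint pushes undo the perturbation.
   All distortions are polynomial in M1 M2 T.  The maps are the identity on the
   hyperplanes separating the slabs, so they glue to H, and F = G o H extends f.
   No surjectivity of G is used.  The same construction with T = 1 realises block
   permutations, which gives beta_d(t) <= 2^(8dt).

   Lower bound for beta_d.  Exchange opposite corners 0 and v of the block.  If
   d >= 3 the bound follows from looking at the distance to the fixed point at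
   height 1/2 over the origin.  If d = 2 this is not enough, and one uses that two
   crossing paths in a rectangle meet. *)

Require Import Defs.
From HB Require Import structures.
From mathcomp Require Import all_boot all_order all_algebra.
From mathcomp Require Import boolp classical_sets reals exp.
From mathcomp Require Import ring lra zify.
Import Order.TTheory GRing.Theory Num.Theory.
Local Open Scope classical_set_scope.
Local Open Scope ring_scope.

(** * The sup distance *)

(** The explicit maps below change coordinates separately, so estimates in this distance are linear
    coordinate by coordinate. The Euclidean distance is recovered only afterwards. *)
Definition supd {R : realType} {n : nat} (x y : pt R n) : R :=
  \big[Num.max/0]_(i < n) `|x i - y i|.

Definition sup_bilip {R : realType} {n : nat} (H : pt R n -> pt R n) (C : R) :=
  forall x y, supd (H x) (H y) <= C * supd x y /\
              supd x y <= C * supd (H x) (H y).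

Lemma supd_ge0 {R : realType} {n : nat} (x y : pt R n) : 0 <= supd x y.
Proof. by rewrite /supd; elim/big_rec: _ => // i z _ z0; rewrite le_max z0 orbT. Qed.

Lemma coord_le_supd {R : realType} {n : nat} (x y : pt R n) i :
  `|x i - y i| <= supd x y.
Proof. exact: (le_bigmax_cond 0 (fun i => `|x i - y i|)). Qed.

Lemma supd_le {R : realType} {n : nat} (x y : pt R n) (r : R) :
  0 <= r -> (forall i, `|x i - y i| <= r) -> supd x y <= r.
Proof. by move=> r0 h; apply: bigmax_le. Qed.

Lemma supdC {R : realType} {n : nat} (x y : pt R n) : supd x y = supd y x.
Proof. by apply: eq_bigr => i _; rewrite distrC. Qed.

Lemma supd_triangle {R : realType} {n : nat} (y x z : pt R n) :
  supd x z <= supd x y + supd y z.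
Proof.
apply: supd_le => [|i]; first by rewrite addr_ge0 ?supd_ge0.
by rewrite (le_trans (ler_distD (y i) _ _)) // lerD ?coord_le_supd.
Qed.

Lemma supd_xx {R : realType} {n : nat} (x : pt R n) : supd x x = 0.
Proof.
by apply/le_anti; rewrite supd_ge0 andbT supd_le // => i; rewrite subrr normr0.
Qed.

Lemma supd_eq0 {R : realType} {n : nat} (x y : pt R n) : supd x y <= 0 -> x = y.
Proof.
move=> h; apply: funext => i; apply/eqP; rewrite -subr_eq0 -normr_le0.
exact: le_trans (coord_le_supd _ _ _) h.
Qed.

Lemma sup_bilip_inj {R : realType} {n : nat} {H : pt R n -> pt R n} {C : R} :
  sup_bilip H C -> injective H.
Proof.
move=> hH x y e; apply: supd_eq0.
by have [_] := hH x y; rewrite e supd_xx mulr0.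
Qed.

Lemma sup_bilip_comp {R : realType} {n : nat} {H K : pt R n -> pt R n} {C D : R} :
  0 <= C -> 0 <= D ->
  sup_bilip H C -> sup_bilip K D -> sup_bilip (H \o K) (C * D).
Proof.
move=> C0 D0 hH hK x y; have [h1 h2] := hH (K x) (K y); have [k1 k2] := hK x y.
split => /=.
  by apply: (le_trans h1); rewrite -mulrA ler_wpM2l.
by apply: (le_trans k2); rewrite (mulrC C) -mulrA ler_wpM2l.
Qed.

Lemma sup_bilip_le {R : realType} {n : nat} {H : pt R n -> pt R n} {C D : R} :
  C <= D -> sup_bilip H C -> sup_bilip H D.
Proof.
move=> CD hH x y; have [h1 h2] := hH x y.
split; [apply: (le_trans h1)|apply: (le_trans h2)];
  by rewrite ler_wpM2r ?supd_ge0.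
Qed.

(** * Comparison with the Euclidean distance *)

Lemma edist_ge0 {R : realType} {n : nat} (x y : pt R n) : 0 <= edist x y.
Proof. exact: sqrtr_ge0. Qed.

Lemma edist_xx {R : realType} {n : nat} (x : pt R n) : edist x x = 0.
Proof.
by rewrite /edist big1 ?sqrtr0 // => i _; rewrite subrr expr0n.
Qed.

Lemma coord_le_edist {R : realType} {n : nat} (x y : pt R n) i :
  `|x i - y i| <= edist x y.
Proof.
rewrite /edist distrC -sqrtr_sqr ler_sqrt ?sumr_ge0 // => [|j _]; last exact: sqr_ge0.
by rewrite (bigD1 i) //= lerDl sumr_ge0 // => j _; exact: sqr_ge0.
Qed.

Lemma edist_eq0 {R : realType} {n : nat} (x y : pt R n) : edist x y <= 0 -> x = y.
Proof.
move=> h; apply: funext => i; apply/eqP; rewrite -subr_eq0 -normr_le0.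
exact: le_trans (coord_le_edist _ _ _) h.
Qed.

Lemma edist_gt0 {R : realType} {n : nat} (x y : pt R n) : x <> y -> 0 < edist x y.
Proof. by move=> h; rewrite ltNge; apply/negP => /edist_eq0. Qed.

Lemma supd_le_edist {R : realType} {n : nat} (x y : pt R n) : supd x y <= edist x y.
Proof. by apply: supd_le; [exact: edist_ge0|exact: coord_le_edist]. Qed.

Lemma edist_le_supd {R : realType} {n : nat} (x y : pt R n) :
  edist x y <= Num.sqrt n%:R * supd x y.
Proof.
have d0 := supd_ge0 x y.
have -> : Num.sqrt n%:R * supd x y = Num.sqrt (n%:R * supd x y ^+ 2).
  by rewrite sqrtrM ?ler0n // sqrtr_sqr ger0_norm.
rewrite /edist; apply: ler_wsqrtr.
have -> : n%:R * supd x y ^+ 2 = \sum_(i < n) supd x y ^+ 2.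
  by rewrite sumr_const card_ord mulr_natl.
apply: ler_sum => i _; have := coord_le_supd x y i; rewrite ler_norml => /andP[? ?].
nra.
Qed.

Lemma edist_last {R : realType} {n : nat} (x y : pt R n) i :
  (forall j, j != i -> x j = y j) -> edist x y = `|x i - y i|.
Proof.
move=> h; rewrite /edist (bigD1 i) //= big1 ?addr0 ?sqrtr_sqr 1?distrC // => j ji.
by rewrite h // subrr expr0n.
Qed.

Lemma bilip_onW {R : realType} {n : nat} {A : set (pt R n)} {g : pt R n -> pt R n} {L : R} :
  bilip_on A g L -> forall x y, A x -> A y ->
  edist (g x) (g y) <= L * edist x y /\ edist x y <= L * edist (g x) (g y).
Proof.
move=> h x y Ax Ay; have [->|xy] := pselect (x = y); last exact: h.
by rewrite !edist_xx mulr0.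
Qed.

(** A single factor sqrt n is lost, because [supd] is at most [edist]. *)
Lemma sup_bilip_on {R : realType} {n : nat} {H : pt R n -> pt R n} {C : R} :
  0 <= C -> sup_bilip H C -> bilip_on setT H (Num.sqrt n%:R * C).
Proof.
move=> C0 hH x y _ _ _; have [h1 h2] := hH x y; split;
  apply: (le_trans (edist_le_supd _ _)); rewrite -mulrA ler_wpM2l ?sqrtr_ge0 //.
  by apply: (le_trans h1); rewrite ler_wpM2l ?supd_le_edist.
by apply: (le_trans h2); rewrite ler_wpM2l ?supd_le_edist.
Qed.

(** If L < 1, the first inequality brings the two images strictly closer together, which makes the
    second one fail. *)
Lemma bilip_const_ge1 {R : realType} {n : nat} {A : set (pt R n)}
    {g : pt R n -> pt R n} {L : R} {x y : pt R n} :
  bilip_on A g L -> A x -> A y -> x <> y -> 1 <= L.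
Proof.
move=> h Ax Ay xy; have [h1 h2] := h _ _ Ax Ay xy.
have d0 := edist_gt0 _ _ xy; have e0 := edist_ge0 (g x) (g y).
rewrite leNgt; apply/negP => L1.
have ed : edist (g x) (g y) < edist x y by apply: (le_lt_trans h1); rewrite gtr_pMl.
have : L * edist (g x) (g y) <= edist (g x) (g y) by rewrite ler_piMl // ltW.
by rewrite leNgt (lt_le_trans ed).
Qed.

(** * Explicit bilipschitz maps *)

(** The condition [K * u x k = 0] covers two situations at once: K = 0, or a displacement that
    leaves coordinate [k] alone. In both, the term with K has the same value for the points and for
    their images, so it does not spoil the lower bound. *)
Lemma perturb_bilip {R : realType} {n : nat} (k : 'I_n) (K : R) (u : pt R n -> pt R n) :
  0 <= K ->
  (forall x y i, `|u x i - u y i| <= supd x y / 2 + K * `|x k - y k|) ->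
  (forall x, K * u x k = 0) ->
  sup_bilip (fun x i => x i + u x i) (2 * (1 + K)).
Proof.
move=> K0 hu hk x y; set X := (X in supd X _); set Y := (X in supd _ X).
have hK : K * `|x k - y k| = K * `|X k - Y k|.
  rewrite -(ger0_norm K0) -!normrM /X /Y; congr (`| _ |).
  have := hk x; have := hk y; lra.
have d0 := supd_ge0 x y; have D0 := supd_ge0 X Y.
have k1 : K * `|x k - y k| <= K * supd x y by rewrite ler_wpM2l ?coord_le_supd.
have k2 : K * `|x k - y k| <= K * supd X Y by rewrite hK ler_wpM2l ?coord_le_supd.
have Kd : 0 <= K * supd x y by rewrite mulr_ge0.
have KD : 0 <= K * supd X Y by rewrite mulr_ge0.
split.
  apply: supd_le => [|i]; first by apply: mulr_ge0 => //; lra.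
  have := hu x y i; have := coord_le_supd x y i.
  rewrite /X /Y !ler_norml => /andP[? ?] /andP[? ?]; apply/andP; split; lra.
(* The 1/2-Lipschitz part of the displacement is absorbed by the left side, which gives the factor 2
   in the constant. *)
suff : supd x y <= supd X Y + supd x y / 2 + K * supd X Y by lra.
apply: supd_le => [|i]; first lra.
have := hu x y i; have := coord_le_supd X Y i.
rewrite {1 2}/X {1 2}/Y !ler_norml => /andP[? ?] /andP[? ?]; apply/andP; split; lra.
Qed.

Definition upd {R : realType} {n : nat} (x : pt R n) (k : 'I_n) (c : R) : pt R n :=
  fun i => if i == k then c else x i.

Lemma updk {R : realType} {n : nat} (x : pt R n) k c : upd x k c k = c.
Proof. by rewrite /upd eqxx. Qed.

Lemma updN {R : realType} {n : nat} (x : pt R n) k c i : i != k -> upd x k c i = x i.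
Proof. by rewrite /upd => /negPf->. Qed.

Lemma upd_id {R : realType} {n : nat} (x : pt R n) k : upd x k (x k) = x.
Proof. by apply: funext => i; rewrite /upd; case: eqP => // ->. Qed.

(** The points x and y are compared through z, the point on the fibre of x at the height of y. The
    pair x, z tests [g] along a fibre and the pair z, y tests it at constant height. Since the other
    coordinates are kept, z is no farther from y than x is, nor than X is from Y. *)
Lemma fiber_bilip {R : realType} {n : nat} (k : 'I_n) (mu nu K C : R) (g : pt R n -> R) :
  0 < mu -> 0 <= nu -> 0 <= K -> nu + K <= C -> 1 + K <= mu * C -> 1 <= C ->
  (forall x y, (forall i, i != k -> x i = y i) ->
     mu * `|x k - y k| <= `|g x - g y| <= nu * `|x k - y k|) ->
  (forall x y, x k = y k -> `|g x - g y| <= K * supd x y) ->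
  sup_bilip (fun x => upd x k (g x)) C.
Proof.
move=> mu0 nu0 K0 hC1 hC2 hC3 gv gh x y; set X := upd x k _; set Y := upd y k _.
pose z := upd x k (y k).
have d0 := supd_ge0 x y; have D0 := supd_ge0 X Y.
have zk : z k = y k by rewrite /z updk.
have /andP[v1 v2] : mu * `|x k - z k| <= `|g x - g z| <= nu * `|x k - z k|.
  by apply: gv => i ik; rewrite /z updN.
have h := gh z y zk; rewrite zk in v1 v2.
have z1 : supd z y <= supd x y.
  apply: supd_le => // i; rewrite /z /upd.
  by case: eqP => [->|_]; rewrite ?subrr ?normr0 ?supd_ge0 ?coord_le_supd.
have XY i : i != k -> X i - Y i = x i - y i by move=> ik; rewrite /X /Y !updN.
have z2 : supd z y <= supd X Y.
  apply: supd_le => // i; have [->|ik] := eqVneq i k; first by rewrite zk subrr normr0.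
  by rewrite /z updN // -XY // coord_le_supd.
have kz1 : K * supd z y <= K * supd x y by rewrite ler_wpM2l.
have kz2 : K * supd z y <= K * supd X Y by rewrite ler_wpM2l.
have kx : `|x k - y k| <= supd x y by apply: coord_le_supd.
have kX : `|g x - g y| <= supd X Y.
  by have := coord_le_supd X Y k; rewrite /X /Y !updk.
have tr1 : `|g x - g y| <= `|g x - g z| + `|g z - g y| by apply: ler_distD.
have tr2 : `|g x - g z| <= `|g x - g y| + `|g z - g y|.
  by rewrite [`|g z - g y|]distrC; apply: ler_distD.
split; (apply: supd_le => [|i]; first by apply: mulr_ge0 => //; lra).
- have [->|ik] := eqVneq i k.
    rewrite /X /Y !updk; have : nu * `|x k - y k| <= nu * supd x y by rewrite ler_wpM2l.
    have : (nu + K) * supd x y <= C * supd x y by rewrite ler_wpM2r.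
    lra.
  rewrite XY // (le_trans (coord_le_supd _ _ _)) //.
  by rewrite ler_peMl.
- have [->|ik] := eqVneq i k.
    rewrite -(ler_pM2l mu0) mulrA.
    have : (1 + K) * supd X Y <= mu * C * supd X Y by rewrite ler_wpM2r.
    lra.
  rewrite -XY // (le_trans (coord_le_supd _ _ _)) //.
  by rewrite ler_peMl.
Qed.

(** Replaces a sum over a possibly infinite family with disjoint supports by its only term that can
    be nonzero. Off all supports the value of the index is arbitrary. *)
Lemma disjoint_supports_index {R : realType} {I X : Type} (i0 : I) (F : I -> X -> R) :
  (forall x i j, F i x != 0 -> F j x != 0 -> i = j) ->
  exists ix : X -> I, forall x j, F j x != 0 -> j = ix x.
Proof.
move=> h.
suff /choice[ix hix] : forall x, exists i, forall j, F j x != 0 -> j = i by exists ix.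
move=> x; have [[i hi]|hn] := pselect (exists i, F i x != 0).
  by exists i => j hj; apply: h hj hi.
by exists i0 => j hj; case: hn; exists j.
Qed.

(* Passing between two different supports costs a factor two. *)
Lemma disjoint_sum_lip {R : realType} {I X : Type} (F : I -> X -> R) (ix : X -> I)
    (c : R) (x y : X) :
  (forall x j, F j x != 0 -> j = ix x) ->
  (forall i, `|F i x - F i y| <= c) ->
  `|F (ix x) x - F (ix y) y| <= 2 * c.
Proof.
move=> h hc; have c0 : 0 <= c := le_trans (normr_ge0 _) (hc (ix x)).
have [e|ne] := pselect (ix x = ix y).
  by rewrite e (le_trans (hc _)) //; lra.
have e1 : F (ix x) y = 0 by apply: contra_notP ne => /eqP/h.
have e2 : F (ix y) x = 0.
  by apply: contra_notP ne => /eqP/h.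
have := hc (ix x); have := hc (ix y); rewrite e1 e2 !ler_norml.
by move=> /andP[? ?] /andP[? ?]; apply/andP; split; lra.
Qed.

Definition bump {R : realType} (r : R) : R := if r < 1 then 1 - r else 0.

Lemma bump_lip {R : realType} (r s : R) : `|bump r - bump s| <= `|r - s|.
Proof.
have h1 := ler_norm (r - s); have h2 := ler_norm (s - r).
rewrite (distrC s r) in h2; rewrite ler_norml /bump.
by case: (ltrP r 1) => ?; case: (ltrP s 1) => ?; apply/andP; split; lra.
Qed.

Lemma bump0 {R : realType} : bump (0 : R) = 1.
Proof. by rewrite /bump ltr01 subr0. Qed.

Lemma bump_lt1 {R : realType} (r : R) : bump r != 0 -> r < 1.
Proof. by rewrite /bump; case: (ltrP r 1); rewrite ?eqxx. Qed.

Lemma bump_itv {R : realType} (r : R) : 0 <= r -> 0 <= bump r <= 1.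
Proof. by rewrite /bump; case: (ltrP r 1) => ? ?; apply/andP; split; lra. Qed.

(** The map adds [bump (w i x)] times the vector from [c i] to [t i]. Supports have radius 4V, so
    each displacement is 1/4-Lipschitz up to the kappa term, and 1/2-Lipschitz after the loss in
    [disjoint_sum_lip], as [perturb_bilip] demands. A positive kappa flattens the supports to
    half-thickness 1/kappa in direction [k]; the displacement must then be orthogonal to that
    direction. *)
Lemma move_points {R : realType} {n : nat} {I : Type} (i0 : I) (k : 'I_n)
    (V kappa : R) (c t : I -> pt R n) :
  let w i x := supd x (c i) / (4 * V) + kappa * `|x k - c i k| in
  0 < V -> 0 <= kappa ->
  (forall i a, `|t i a - c i a| <= V) ->
  (forall i, kappa * (t i k - c i k) = 0) ->
  (forall x i j, w i x < 1 -> w j x < 1 -> i = j) ->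
  exists Phi : pt R n -> pt R n,
    [/\ sup_bilip Phi (2 * (1 + 2 * V * kappa)),
        forall i, Phi (c i) = t i &
        forall x, (forall i, 1 <= w i x) -> Phi x = x].
Proof.
move=> w V0 k0 tV tk disj.
have [x i j hi hj|ix hix] := disjoint_supports_index i0 (fun i x => bump (w i x)).
  by apply: (disj x); apply: bump_lt1.
pose F a i (x : pt R n) := bump (w i x) * (t i a - c i a).
have hF a x j : F a j x != 0 -> j = ix x.
  by rewrite /F mulf_eq0 negb_or => /andP[/hix].
exists (fun x i => x i + F i (ix x) x); split.
- apply: (perturb_bilip k); first by rewrite !mulr_ge0 // ltW.
    move=> x y a; rewrite (_ : _ + _ = 2 * (supd x y / 4 + V * kappa * `|x k - y k|)); last by field.
    apply: disjoint_sum_lip => [z j /hF //|i].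
    rewrite /F -mulrBl normrM.
    apply: (@le_trans _ _ (`|w i x - w i y| * V)); first by rewrite ler_pM ?normr_ge0 ?bump_lip.
    rewrite -[supd x y / 4](_ : supd x y / (4 * V) * V = _); last by field; rewrite gt_eqF.
    rewrite -[V * _ * _]mulrA [V * _]mulrC -mulrDl ler_wpM2r ?(ltW V0) //.
    have h1 : `|supd x (c i) - supd y (c i)| <= supd x y.
      have := supd_triangle y x (c i); have := supd_triangle x y (c i).
      rewrite (supdC y x) ler_norml => ? ?; apply/andP; split; lra.
    have h2 : `| `|x k - c i k| - `|y k - c i k| | <= `|x k - y k|.
      apply: le_trans (ler_dist_dist _ _) _.
      by rewrite opprB addrA subrK.
    rewrite /w (_ : _ - _ = (supd x (c i) - supd y (c i)) / (4 * V) +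
       kappa * (`|x k - c i k| - `|y k - c i k|)); last by ring.
    apply: le_trans (ler_normD _ _) _; rewrite lerD // normrM.
      have V4 : 0 <= (4 * V)^-1 by rewrite invr_ge0; lra.
      by rewrite (ger0_norm V4) ler_wpM2r.
    by rewrite (ger0_norm k0) ler_wpM2l.
  move=> x; rewrite /F; move: (bump _) => B.
  rewrite (_ : _ * (B * _) = 2 * V * B * (kappa * (t (ix x) k - c (ix x) k))); last by ring.
  by rewrite tk mulr0.
- move=> i; apply: funext => a.
  have e : w i (c i) = 0 by rewrite /w supd_xx subrr normr0 mul0r mulr0 addr0.
  have <- : i = ix (c i) by apply: hix; rewrite e bump0 oner_neq0.
  by rewrite /F e bump0 mul1r addrC subrK.
- move=> x hx; apply: funext => a; rewrite /F /bump ltNge hx /=.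
  by rewrite mul0r addr0.
Qed.

(** * Moving points along parallel lines *)

Definition tent {R : realType} (lo hi a h : R) : R :=
  Num.max 0 (Num.min ((h - lo) / (a - lo)) ((hi - h) / (hi - a))).

(** The rising and the falling slope are bounded separately: a symmetric bound would not keep the
    fibre maps increasing. *)
Lemma tent_variation {R : realType} (lo hi a h h' : R) :
  lo < a -> a < hi -> h <= h' ->
  - ((h' - h) / (hi - a)) <= tent lo hi a h' - tent lo hi a h <= (h' - h) / (a - lo).
Proof.
move=> la ah hh; rewrite /tent.
have p0 : 0 <= (h' - h) / (a - lo) by rewrite divr_ge0 //; lra.
have q0 : 0 <= (h' - h) / (hi - a) by rewrite divr_ge0 //; lra.
have -> : (h' - lo) / (a - lo) = (h - lo) / (a - lo) + (h' - h) / (a - lo) by ring.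
have -> : (hi - h') / (hi - a) = (hi - h) / (hi - a) - (h' - h) / (hi - a) by ring.
move: p0 q0; move: (_ / _) => p; move: ((h' - h) / _) => q.
move: ((h - lo) / _) => A; move: ((hi - h) / _) => B p0 q0.
rewrite /Order.max /Order.min.
by repeat case: ifPn; rewrite -?leNgt => *; apply/andP; split; lra.
Qed.

Lemma tent_itv {R : realType} (lo hi a h : R) :
  lo < a -> a < hi -> 0 <= tent lo hi a h <= 1.
Proof.
move=> la ah; rewrite /tent le_max lexx /= ge_max ler01 /= ge_min.
rewrite !ler_pdivrMr ?subr_gt0 // !mul1r.
by case: (lerP h a) => ?; apply/orP; [left|right]; lra.
Qed.

Lemma tent_peak {R : realType} (lo hi a : R) :
  lo < a -> a < hi -> tent lo hi a a = 1.
Proof.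
move=> la ah; rewrite /tent !divff ?subr_eq0 ?gt_eqF // ?minxx.
by rewrite (max_idPr _).
Qed.

Lemma tent_out {R : realType} (lo hi a h : R) :
  lo < a -> a < hi -> h <= lo \/ hi <= h -> tent lo hi a h = 0.
Proof.
move=> la ah hh; rewrite /tent; apply: max_idPl.
rewrite ge_min !ler_pdivrMr ?subr_gt0 // !mul0r.
by case: hh => ?; apply/orP; [left|right]; lra.
Qed.

(** Here D is an increment of height, tau the corresponding increment of the tent with peak at a,
    and th a cut-off value. For th = 1 the expression is the increment of the piecewise linear
    homeomorphism of [lo, hi] taking a to b, with slopes (b - lo)/(a - lo) and (hi - b)/(hi - a);
    smaller th interpolates with the identity. *)
Lemma fiber_slope {R : realType} (lo hi a b s s1 th D tau : R) :
  0 < s -> 0 < s1 -> lo + s <= b <= hi - s -> lo + s1 <= a <= hi - s1 ->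
  0 <= th <= 1 -> 0 <= D -> - (D / (hi - a)) <= tau <= D / (a - lo) ->
  s / (hi - lo) * D <= D + th * ((b - a) * tau) <= (hi - lo) / s1 * D.
Proof.
move=> s0 s10 /andP[b1 b2] /andP[a1 a2] /andP[t0 t1] D0.
have P0 : 0 < a - lo by lra.
have Q0 : 0 < hi - a by lra.
have T0 : 0 < hi - lo by lra.
set p := D / (a - lo); set q := D / (hi - a).
have eP : D = (a - lo) * p by rewrite /p mulrC divfK ?gt_eqF.
have eQ : D = (hi - a) * q by rewrite /q mulrC divfK ?gt_eqF.
have p0 : 0 <= p by rewrite divr_ge0 // ltW.
have q0 : 0 <= q by rewrite divr_ge0 // ltW.
have lP : D / (hi - lo) <= p by rewrite ler_wpM2l // lef_pV2 ?posrE //; lra.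
have lQ : D / (hi - lo) <= q by rewrite ler_wpM2l // lef_pV2 ?posrE //; lra.
have uP : p <= D / s1 by rewrite ler_wpM2l // lef_pV2 ?posrE //; lra.
have uQ : q <= D / s1 by rewrite ler_wpM2l // lef_pV2 ?posrE //; lra.
rewrite (_ : s / (hi - lo) * D = s * (D / (hi - lo))); last by ring.
rewrite (_ : (hi - lo) / s1 * D = (hi - lo) * (D / s1)); last by ring.
move: lP lQ uP uQ; move: (D / (hi - lo)) (D / s1) => dT ds lP lQ uP uQ /andP[x1 x2].
(* When a <= b the steep side is below a and the flat side above it; when b < a the roles are
   exchanged. *)
have [ba|ba] := lerP a b.
  have h1 : th * ((b - a) * tau) <= (b - a) * p.
    have : (b - a) * tau <= (b - a) * p by rewrite ler_wpM2l //; lra.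
    have : 0 <= (b - a) * p by rewrite mulr_ge0 //; lra.
    move: ((b - a) * tau) ((b - a) * p) => X Y; nra.
  have h2 : - ((b - a) * q) <= th * ((b - a) * tau).
    have : (b - a) * - q <= (b - a) * tau by rewrite ler_wpM2l //; lra.
    have : 0 <= (b - a) * q by rewrite mulr_ge0 //; lra.
    rewrite mulrN; move: ((b - a) * tau) ((b - a) * q) => X Y; nra.
  apply/andP; split.
    apply: (@le_trans _ _ ((hi - b) * q)); last by rewrite {1}eQ; lra.
    by rewrite (le_trans (y := s * q)) ?ler_wpM2l ?ler_wpM2r //; lra.
  apply: (@le_trans _ _ ((b - lo) * p)); first by rewrite {1}eP; lra.
  by rewrite (le_trans (y := (hi - lo) * p)) ?ler_wpM2l ?ler_wpM2r //; lra.
have h1 : th * ((b - a) * tau) <= (a - b) * q.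
  have : (a - b) * - tau <= (a - b) * q by rewrite ler_wpM2l //; lra.
  have : 0 <= (a - b) * q by rewrite mulr_ge0 //; lra.
  rewrite (_ : (a - b) * - tau = (b - a) * tau); last by ring.
  move: ((b - a) * tau) ((a - b) * q) => X Y; nra.
have h2 : - ((a - b) * p) <= th * ((b - a) * tau).
  have : (a - b) * tau <= (a - b) * p by rewrite ler_wpM2l //; lra.
  have : 0 <= (a - b) * p by rewrite mulr_ge0 //; lra.
  rewrite (_ : (a - b) * tau = - ((b - a) * tau)); last by ring.
  move: ((b - a) * tau) ((a - b) * p) => X Y; nra.
apply/andP; split.
  apply: (@le_trans _ _ ((b - lo) * p)); last by rewrite {1}eP; lra.
  by rewrite (le_trans (y := s * p)) ?ler_wpM2l ?ler_wpM2r //; lra.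
apply: (@le_trans _ _ ((hi - b) * q)); first by rewrite {1}eQ; lra.
by rewrite (le_trans (y := (hi - lo) * q)) ?ler_wpM2l ?ler_wpM2r //; lra.
Qed.

(** The cut-off depends only on the projection [fl x] along direction [k]. Its supports are tubes of
    radius delta/2 around the lines through the points [c i], hence disjoint. Across fibres, a shift
    of at most hi - lo times the cut-off slope 2/delta, doubled by [disjoint_sum_lip], gives 4(hi -
    lo)/delta. *)
Lemma move_fibers {R : realType} {n : nat} {I : Type} (i0 : I) (k : 'I_n)
    (lo hi s s1 delta C : R) (c : I -> pt R n) (b : I -> R) :
  0 < s -> 0 < s1 -> 0 < delta ->
  (forall i, lo + s <= b i <= hi - s) ->
  (forall i, lo + s1 <= c i k <= hi - s1) ->
  (forall i j, i <> j -> exists a, a != k /\ delta <= `|c i a - c j a|) ->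
  (hi - lo) / s1 + 4 * (hi - lo) / delta <= C ->
  1 + 4 * (hi - lo) / delta <= s / (hi - lo) * C ->
  exists Phi : pt R n -> pt R n,
    [/\ sup_bilip Phi C,
        forall i, Phi (c i) = upd (c i) k (b i) &
        forall x, x k <= lo \/ hi <= x k -> Phi x = x].
Proof.
move=> s0 s10 d0 hb hc sep hC1 hC2.
have T0 : 0 < hi - lo by have /andP[? ?] := hc i0; lra.
have la i : lo < c i k by have /andP[? ?] := hc i; lra.
have ah i : c i k < hi by have /andP[? ?] := hc i; lra.
pose fl (x : pt R n) := upd x k 0.
have fl_le x y : supd (fl x) (fl y) <= supd x y.
  apply: supd_le => [|a]; first exact: supd_ge0.
  by rewrite /fl /upd; case: eqP => _; rewrite ?subrr ?normr0 ?supd_ge0 ?coord_le_supd.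
pose w i x := supd (fl x) (fl (c i)) * (2 / delta).
have d20 : 0 < 2 / delta by rewrite divr_gt0.
have disj x i j : bump (w i x) != 0 -> bump (w j x) != 0 -> i = j.
  move=> /bump_lt1 hi' /bump_lt1 hj; apply: contrapT => ij.
  have [a [ak da]] := sep _ _ ij.
  have : delta * (2 / delta) < 2.
    apply: (@le_lt_trans _ _ (supd (fl x) (fl (c i)) * (2 / delta)
                             + supd (fl x) (fl (c j)) * (2 / delta))).
      rewrite -mulrDl ler_wpM2r ?(ltW d20) //.
      have := coord_le_supd (fl x) (fl (c i)) a; have := coord_le_supd (fl x) (fl (c j)) a.
      rewrite /fl !updN // (distrC (x a) (c i a)).
      have := ler_distD (x a) (c i a) (c j a); lra.
    by rewrite /w in hi' hj; lra.
  by rewrite mulrCA divff ?gt_eqF // mulr1 ltxx.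
have [ix hix] := disjoint_supports_index i0 (fun i x => bump (w i x)) disj.
pose F i (x : pt R n) := bump (w i x) * ((b i - c i k) * tent lo hi (c i k) (x k)).
have w_ge0 i x : 0 <= w i x by rewrite mulr_ge0 ?supd_ge0 // ltW.
have ffl x : fl (fl x) = fl x.
  by apply: funext => a; rewrite /fl /upd; case: eqP.
have wfl i x : w i (fl x) = w i x by rewrite /w ffl.
have hF x j : F j x != 0 -> j = ix (fl x).
  by rewrite /F mulf_eq0 negb_or => /andP[+ _]; rewrite -wfl => /hix.
(* Evaluating the index at [fl x] makes it constant on every fibre, also off the tubes where its
   value is arbitrary. *)
pose g x := x k + F (ix (fl x)) x.
have K0 : 0 <= 4 * (hi - lo) / delta by rewrite divr_ge0 ?mulr_ge0 // ltW.
have slope x y : fl x = fl y -> y k <= x k ->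
    s / (hi - lo) * (x k - y k) <= g x - g y <= (hi - lo) / s1 * (x k - y k).
  move=> e yx; rewrite /g -e; set i := ix _.
  have -> : x k + F i x - (y k + F i y) = (x k - y k) + bump (w i x) * ((b i - c i k) *
      (tent lo hi (c i k) (x k) - tent lo hi (c i k) (y k))).
    by rewrite /F -(wfl i y) -e wfl; ring.
  apply: fiber_slope => //; rewrite ?subr_ge0 ?bump_itv //.
  exact: tent_variation.
have slope_norm x y : fl x = fl y ->
    s / (hi - lo) * `|x k - y k| <= `|g x - g y| <= (hi - lo) / s1 * `|x k - y k|.
  have mono u v : fl u = fl v -> v k <= u k -> s / (hi - lo) * `|u k - v k|
      <= `|g u - g v| <= (hi - lo) / s1 * `|u k - v k|.
    move=> e vu; have /andP[h1 h2] := slope _ _ e vu.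
    have uv0 : 0 <= u k - v k by rewrite subr_ge0.
    have g0 : 0 <= g u - g v.
      by apply: le_trans h1; rewrite mulr_ge0 // divr_ge0 // ltW.
    by rewrite !ger0_norm // h1 h2.
  move=> e; have /orP[yx|yx] := le_total (y k) (x k); first exact: mono.
  by rewrite (distrC (x k)) (distrC (g x)); apply: mono.
exists (fun x => upd x k (g x)); split.
- apply: (fiber_bilip k (s / (hi - lo)) ((hi - lo) / s1) (4 * (hi - lo) / delta)) => //.
  + by rewrite divr_gt0.
  + by rewrite divr_ge0 // ltW.
  + apply: le_trans hC1; rewrite -[X in X <= _]addr0 lerD //.
    by rewrite ler_pdivlMr // mul1r; have /andP[? ?] := hc i0; lra.
  + move=> x y xy.
    have e : fl x = fl y.
      by apply: funext => a; rewrite /fl /upd; case: eqP => // /eqP ak; exact: xy.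
    exact: slope_norm.
  + move=> x y xy; rewrite /g xy opprD addrACA subrr add0r.
    pose c' := (hi - lo) * (supd x y * (2 / delta)).
    rewrite (_ : _ * _ = 2 * c'); last by rewrite /c'; field; rewrite gt_eqF.
    apply: (disjoint_sum_lip F (ix \o fl)) => [//|i].
    rewrite /F xy -mulrBl normrM mulrC /c' ler_pM //.
      have /andP[t0 t1] := tent_itv _ _ _ (y k) (la i) (ah i).
      rewrite normrM (ger0_norm t0) -[leRHS]mulr1 ler_pM //.
      have /andP[? ?] := hb i; have /andP[? ?] := hc i.
      by rewrite ler_norml; apply/andP; split; lra.
    apply: le_trans (bump_lip _ _) _.
    rewrite /w -mulrBl normrM (gtr0_norm d20) ler_wpM2r ?(ltW d20) //.
    apply: le_trans (fl_le x y).
    have := supd_triangle (fl y) (fl x) (fl (c i)).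
    have := supd_triangle (fl x) (fl y) (fl (c i)).
    by rewrite (supdC (fl y) (fl x)) ler_norml => ? ?; apply/andP; split; lra.
- move=> i; congr upd; rewrite /g.
  have e : w i (c i) = 0 by rewrite /w supd_xx mul0r.
  have <- : i = ix (fl (c i)) by apply: hix; rewrite wfl e bump0 oner_neq0.
  by rewrite /F e bump0 tent_peak // mul1r mulr1 addrC subrK.
- move=> x hx; rewrite -[RHS](upd_id x k); congr upd.
  by rewrite /g /F tent_out // !mulr0 addr0.
Qed.

(** * Extension in one slab *)

(** The colour records the level inside the slab and the horizontal coordinates modulo W. Two
    distinct points with the same colour then differ by a nonzero multiple of W in some horizontal
    coordinate. *)
Lemma lattice_coloring (m T W : nat) (a : int) : (0 < T)%N -> (0 < W)%N ->
  exists col : ('I_m.+1 -> int) -> nat,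
    (forall z, (col z < W ^ m * T)%N) /\
    forall z w, a < z ord_max <= a + T%:Z -> a < w ord_max <= a + T%:Z ->
      col z = col w -> z <> w ->
      z ord_max = w ord_max /\
      exists i, i != ord_max /\ W%:Z <= `|z i - w i|.
Proof.
case: T => // T _; case: W => // W _.
pose code (z : 'I_m.+1 -> int) : {ffun 'I_m -> 'I_W.+1} * 'I_T.+1 :=
  ([ffun i => inord (absz (z (lift ord_max i) %% W.+1%:Z)%Z)],
   (* Inside the slab this difference runs over 0, ..., T - 1; elsewhere [inord] falls back on some
      value, so the bound on colours holds for every z. *)
   inord (absz (z ord_max - a - 1)%R)).
have card_code : #|{: {ffun 'I_m -> 'I_W.+1} * 'I_T.+1}| = (W.+1 ^ m * T.+1)%N.
  by rewrite card_prod card_ffun !card_ord.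
exists (fun z => nat_of_ord (enum_rank (code z))); split.
  by move=> z; rewrite -card_code ltn_ord.
move=> z w hz hw /val_inj/enum_rank_inj[hres hlast] zw.
have lastE : z ord_max = w ord_max.
  have := congr1 val hlast; rewrite /= !inordK; lia.
split=> //.
have [i zi] : exists i, z i <> w i.
  by apply: contrapT => h; apply: zw; apply: funext => i; apply: contrapT => zi; apply: h; exists i.
have im : i != ord_max by apply/eqP => e; rewrite e lastE in zi.
exists i; split => //.
have [j ej] : exists j, i = lift ord_max j.
  by case: (unliftP ord_max i) im => [j ->|->]; [exists j|rewrite eqxx].
have := congr1 (fun f : {ffun 'I_m -> 'I_W.+1} => val (f (j : 'I_m))) hres; rewrite /= !ffunE -ej.
rewrite /= !inordK; try lia.
have W0 : (W.+1%:Z != 0)%R by [].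
have := modz_ge0 (z i) W0; have := modz_ge0 (w i) W0 => h1 h2 h3.
have e : ((z i) %% W.+1 = (w i) %% W.+1)%Z by lia.
have /dvdzP[c hc] : (W.+1%:Z %| z i - w i)%Z by rewrite -eqz_mod_dvd; apply/eqP.
rewrite hc; have c0 : c != 0 by apply/eqP => c0; apply: zi; rewrite c0 in hc; lia.
rewrite normrM; nia.
Qed.

Lemma int_dist_ge1 {R : realType} (a b : int) : a != b -> 1 <= `|a%:~R - b%:~R : R|.
Proof. by move=> ab; rewrite -intrB -intr_norm -[1]/(1%:~R) ler_int; lia. Qed.

Lemma emb_far {R : realType} (n : nat) (z w : 'I_n -> int) :
  z <> w -> exists i, 1 <= `|emb z i - emb w i : R|.
Proof.
move=> zw; have [i zi] : exists i, z i <> w i.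
  by apply: contrapT => h; apply: zw; apply: funext => i; apply: contrapT => zi; apply: h; exists i.
by exists i; apply: int_dist_ge1; apply/eqP.
Qed.

Definition slab_lat {m : nat} (a : int) (T : nat) : Type :=
  {z : 'I_m.+1 -> int | a < z ord_max <= a + T%:Z}.

(** The bounding hyperplanes lie at half-integer heights and count as outside; the lattice levels
    strictly between them are a + 1, ..., a + T. *)
Definition slab_out {R : realType} {m : nat} (a : int) (T : nat) (x : pt R m.+1) : Prop :=
  x ord_max <= a%:~R + 2^-1 \/ a%:~R + 2^-1 + T%:R <= x ord_max.

Lemma slab_lat_itv {R : realType} {m : nat} {a : int} {T : nat} (z : @slab_lat m a T) :
  a%:~R + 1 <= (emb (sval z) ord_max : R) <= a%:~R + T%:R.
Proof.
case: z => z /= /andP[h1 h2]; rewrite /emb -[1]/(1%:~R) -[T%:R]/(T%:Z%:~R) -!intrD.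
by rewrite !ler_int; apply/andP; split; lia.
Qed.

Lemma slab_out_ge {R : realType} {m : nat} {a : int} {T : nat} (x y : pt R m.+1) (r : R) :
  slab_out a T x ->
  a%:~R + 2^-1 + r <= y ord_max <= a%:~R + 2^-1 + T%:R - r -> r <= supd x y.
Proof.
move=> hx /andP[h1 h2]; apply: le_trans (coord_le_supd _ _ ord_max).
by rewrite ler_normr; apply/orP; case: hx => ?; [right|left]; lra.
Qed.

(** * The four moves inside a slab *)

Section SlabSteps.
Context {R : realType} {m : nat} (a : int) (T D K : nat) (s : R).
Context (q : @slab_lat m a T -> pt R m.+1) (col : @slab_lat m a T -> nat).
Hypotheses (m_gt0 : (0 < m)%N) (T_gt0 : (0 < T)%N) (D_gt0 : (0 < D)%N) (K_gt0 : (0 < K)%N).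
Hypotheses (s_gt0 : 0 < s) (s_le : s <= 2^-1).
Hypothesis q_slab : forall z,
  a%:~R + 2^-1 + s <= q z ord_max <= a%:~R + 2^-1 + T%:R - s.
Hypothesis q_sep : forall z w, z <> w -> 2 * s <= supd (q z) (q w).
Hypothesis q_near : forall z, supd (emb (sval z)) (q z) <= D%:R.
Hypothesis colK : forall z, (col z < K)%N.
Hypothesis col_far : forall z w, col z = col w -> z <> w ->
  sval z ord_max = sval w ord_max /\
  exists i, i != ord_max /\ 16 * D%:R <= `|emb (sval z) i - emb (sval w) i : R|.

Local Notation p z := (emb (sval z) : pt R m.+1).

Let D1 : 1 <= D%:R :> R. Proof. by rewrite ler1n. Qed.
Let T1 : 1 <= T%:R :> R. Proof. by rewrite ler1n. Qed.
Let K1 : 1 <= K%:R :> R. Proof. by rewrite ler1n. Qed.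
Let K0 : 0 < K%:R :> R. Proof. by rewrite ltr0n. Qed.

Local Ltac bounds :=
  have ? := K0; have ? := K1; have ? := D1; have ? := T1;
  have ? := s_gt0; have ? := s_le.

Let base : @slab_lat m a T.
Proof. by exists (fun=> a + 1) => /=; move: T_gt0; lia. Qed.

(** The lift stays below 1/8, so different levels remain far apart and the slab is not left, while
    different colours on one level end up at least 1/(8K) apart. *)
Definition height (z : @slab_lat m a T) : R := p z ord_max + (col z)%:R / (8 * K%:R).

Let colK_R z : (col z)%:R <= K%:R - 1 :> R.
Proof. by rewrite lerBrDr -[1]/(1%:R) -natrD ler_nat addn1. Qed.

Let height_itv z : p z ord_max <= height z <= p z ord_max + 8^-1 - (8 * K%:R)^-1.
Proof.
bounds.
have k0 : 0 < (8 * K%:R : R)^-1 by rewrite invr_gt0; lra.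
rewrite /height lerDl mulr_ge0 ?ler0n ?(ltW k0) //=.
rewrite -addrA lerD2l.
have -> : 8^-1 - (8 * K%:R)^-1 = (K%:R - 1) / (8 * K%:R) :> R by field; rewrite gt_eqF.
by rewrite ler_wpM2r ?(ltW k0).
Qed.

Let height_sep z w : `|height z - height w| < (8 * K%:R)^-1 -> col z = col w.
Proof.
bounds.
have k0 : 0 < (8 * K%:R : R)^-1 by rewrite invr_gt0; lra.
have [e|ne] := eqVneq (sval z ord_max) (sval w ord_max).
  rewrite /height /emb e opprD addrACA subrr add0r -mulrBl normrM (gtr0_norm k0).
  rewrite gtr_pMl //; have [//|h] := eqVneq (col z) (col w).
  have /int_dist_ge1 : (col z)%:Z != (col w)%:Z by lia.
  by move=> /(_ R) h1 h2; move: (le_lt_trans h1 h2); rewrite ltxx.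
move/(int_dist_ge1 (R := R)): ne; rewrite -/(p z ord_max) -/(p w ord_max).
have /andP[? ?] := height_itv z; have /andP[? ?] := height_itv w.
have k1 : (8 * K%:R : R)^-1 <= 8^-1 by rewrite lef_pV2 ?posrE; lra.
rewrite ler_normr ltr_norml => /orP[]? /andP[? ?]; exfalso; lra.
Qed.

(** With V = 1/8 and kappa = 0 the supports are sup balls of radius 1/2 around lattice points, hence
    disjoint and inside the slab. *)
Lemma lift_step : exists Phi : pt R m.+1 -> pt R m.+1,
  [/\ sup_bilip Phi 2, forall z, Phi (p z) = upd (p z) ord_max (height z) &
      forall x, slab_out a T x -> Phi x = x].
Proof.
bounds.
have k0 : 0 < (8 * K%:R : R)^-1 by rewrite invr_gt0; lra.
have [|//|z i|z|x z w|Phi [h1 h2 h3]] :=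
  move_points base (ord_max : 'I_m.+1) (8^-1 : R) 0 (fun z => p z)
    (fun z => upd (p z) ord_max (height z)).
- by rewrite invr_gt0.
- rewrite /upd; case: eqP => [->|_]; last by rewrite subrr normr0 invr_ge0.
  by have /andP[? ?] := height_itv z; rewrite ler_norml; apply/andP; split; lra.
- by rewrite mul0r.
- rewrite !mul0r !addr0 => hz hw; apply: contrapT => zw.
  have [|i hi] := emb_far (R := R) _ (sval z) (sval w).
    by case: z w zw {hz hw} => [z hz] [w hw] /= + e; apply; apply: eq_exist.
  have := coord_le_supd x (p z) i; have := coord_le_supd x (p w) i.
  have := ler_distD (x i) (p z i) (p w i); rewrite (distrC (p z i) (x i)); lra.
exists Phi; split => //; first by move: h1; rewrite mulr0 addr0 mulr1.
move=> x hx; apply: h3 => z; rewrite mul0r addr0.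
have : 2^-1 <= supd x (p z); last by lra.
apply: slab_out_ge hx _; have /andP[? ?] := slab_lat_itv (R := R) z.
by apply/andP; split; lra.
Qed.

Let delta : R := s / (8 * K%:R).
Let delta_gt0 : 0 < delta. Proof. by bounds; rewrite divr_gt0 //; lra. Qed.

(** The first coordinate of [q z] is replaced by a nearby multiple of [delta] whose index is
    congruent to the colour modulo K. The period [delta * K] is s/8, which bounds the change;
    different colours give first coordinates at least [delta] apart. *)
Definition column (z : @slab_lat m a T) : pt R m.+1 :=
  upd (q z) ord0 (delta *
    (K%:Z * Num.floor (q z ord0 / (delta * K%:R)) + (col z)%:Z)%:~R).

Let ord0_last : (ord0 : 'I_m.+1) != ord_max.
Proof. by rewrite -(inj_eq val_inj) /= eq_sym -lt0n. Qed.

Let column_near z i : `|column z i - q z i| <= s / 8.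
Proof.
bounds.
have dK : delta * K%:R = s / 8 by rewrite /delta; field; rewrite gt_eqF.
rewrite /column /upd; case: eqP => [->|_]; last by rewrite subrr normr0; lra.
set y := q z ord0; rewrite dK; have s8 : 0 < s / 8 by lra.
rewrite intrD intrM mulrDr mulrA -[K%:Z%:~R]/(K%:R) dK.
have /andP[f1 f2] := floor_itv (y / (s / 8)).
rewrite ler_pdivlMr // in f1; rewrite ltr_pdivrMr // intrD in f2.
rewrite -[(col z)%:Z%:~R]/((col z)%:R).
have c0 : 0 <= delta * (col z)%:R by rewrite mulr_ge0 // ltW.
have c1 : delta * (col z)%:R <= s / 8.
  rewrite -dK ler_wpM2l ?(ltW delta_gt0) //; have := colK_R z; lra.
by rewrite ler_norml; apply/andP; split; lra.
Qed.

Let column_supd z : supd (column z) (q z) <= s / 8.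
Proof. by bounds; apply: supd_le; [lra|exact: column_near]. Qed.

Let column_last z : column z ord_max = q z ord_max.
Proof. by rewrite /column updN // eq_sym. Qed.

(** For equal colours the lattice points are 16D apart horizontally and each moves by at most D +
    s/8. For different colours the first coordinates lie in different residue classes. *)
Let column_sep z w : z <> w ->
  exists i, i != ord_max /\ delta <= `|column z i - column w i|.
Proof.
bounds.
move=> zw; have [e|ne] := eqVneq (col z) (col w).
  have [_ [i [im hi]]] := col_far _ _ e zw; exists i; split => //.
  have : delta <= s.
    rewrite /delta ler_pdivrMr; last lra.
    by rewrite ler_peMr ?(ltW s_gt0) //; lra.
  have := column_near z i; have := column_near w i.
  have := le_trans (coord_le_supd _ _ i) (q_near z).
  have := le_trans (coord_le_supd _ _ i) (q_near w).
  have := ler_distD (q z i) (p z i) (p w i); have := ler_distD (q w i) (q z i) (p w i).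
  have := ler_distD (column z i) (q z i) (q w i).
  have := ler_distD (column w i) (column z i) (q w i).
  rewrite (distrC (q z i) (column z i)) (distrC (q w i) (p w i)); lra.
exists ord0; split => //; rewrite /column !updk -mulrBr normrM (gtr0_norm delta_gt0).
rewrite ler_peMr ?(ltW delta_gt0) // int_dist_ge1 //.
have := colK z; have := colK w; move: (Num.floor _) (Num.floor _) => A B.
move: (col z) (col w) ne => c1 c2 ne l1 l2; apply/eqP => e.
have : A = B by nia.
by move=> AB; rewrite AB in e; lia.
Qed.

(** Displacements are at most D + s/8, so V = 2D, and the supports have horizontal radius 8D. With
    kappa = 16K their half-thickness is 1/(16K), half of the gap between colours: overlapping
    supports would belong to one colour, and then to points 16D apart. *)
Lemma shear_step : exists Phi : pt R m.+1 -> pt R m.+1,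
  [/\ sup_bilip Phi (2 + 128 * D%:R * K%:R),
      forall z, Phi (upd (p z) ord_max (height z)) = upd (column z) ord_max (height z) &
      forall x, slab_out a T x -> Phi x = x].
Proof.
bounds.
have k0 : 0 < (8 * K%:R : R)^-1 by rewrite invr_gt0; lra.
have [| |z i|z|x z w|Phi [h1 h2 h3]] :=
  move_points base (ord_max : 'I_m.+1) (2 * D%:R : R) (16 * K%:R)
    (fun z => upd (p z) ord_max (height z)) (fun z => upd (column z) ord_max (height z)).
- lra.
- by rewrite mulr_ge0 // ltW.
- rewrite /upd; case: eqP => [_|_]; first by rewrite subrr normr0; lra.
  have := le_trans (coord_le_supd _ _ i) (q_near z); have := column_near z i.
  have := ler_distD (q z i) (column z i) (p z i); rewrite (distrC (q z i)); lra.
- by rewrite !updk subrr mulr0.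
- rewrite !updk => hz hw; apply: contrapT => zw.
  have small u : supd x (upd (p u) ord_max (height u)) / (4 * (2 * D%:R)) +
       16 * K%:R * `|x ord_max - height u| < 1 ->
       supd x (upd (p u) ord_max (height u)) < 8 * D%:R /\
       `|x ord_max - height u| < (8 * K%:R)^-1 / 2.
    move=> h; split.
      have : supd x (upd (p u) ord_max (height u)) / (4 * (2 * D%:R)) < 1.
        by apply: le_lt_trans h; rewrite lerDl !mulr_ge0 // ltW.
      by rewrite ltr_pdivrMr; lra.
    have h' : 16 * K%:R * `|x ord_max - height u| < 1.
      by apply: le_lt_trans h; rewrite lerDr divr_ge0 ?supd_ge0 //; lra.
    rewrite -invfM -[X in _ < X]mul1r ltr_pdivlMr; last by lra.
    lra.
  have [z1 z2] := small _ hz; have [w1 w2] := small _ hw.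
  have e : col z = col w.
    apply: height_sep; have := ler_distD (x ord_max) (height z) (height w).
    rewrite (distrC (height z) (x _)); lra.
  have [_ [i [im hi]]] := col_far _ _ e zw.
  have := coord_le_supd x (upd (p z) ord_max (height z)) i.
  have := coord_le_supd x (upd (p w) ord_max (height w)) i.
  rewrite !(updN _ _ _ i) //.
  have := ler_distD (x i) (p z i) (p w i); rewrite (distrC (p z i) (x i)); lra.
exists Phi; split => //.
  apply: sup_bilip_le h1; lra.
move=> x hx; apply: h3 => z; rewrite updk.
apply: (@le_trans _ _ (16 * K%:R * `|x ord_max - height z|)); last first.
  by rewrite lerDr divr_ge0 ?supd_ge0 //; lra.
have : 8^-1 <= `|x ord_max - height z|.
  have /andP[? ?] := slab_lat_itv (R := R) z; have /andP[? ?] := height_itv z.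
  by rewrite ler_normr; apply/orP; case: hx => ?; [right|left]; lra.
have := normr_ge0 (x ord_max - height z); nra.
Qed.

(** The lifted heights keep distance 3/8 from the bounding hyperplanes, the target heights distance
    s. The dominant term 4T/[delta] = 32TK/s has to be divided by the minimal slope s/T, whence the
    constant. *)
Lemma fiber_step : exists Phi : pt R m.+1 -> pt R m.+1,
  [/\ sup_bilip Phi (33 * T%:R ^+ 2 * K%:R / s ^+ 2),
      forall z, Phi (upd (column z) ord_max (height z)) = column z &
      forall x, slab_out a T x -> Phi x = x].
Proof.
bounds.
have Ts : 0 < T%:R / s by rewrite divr_gt0 //; lra.
have y1 : 1 <= K%:R / s by rewrite ler_pdivlMr // mul1r; lra.
have e1 : 4 * T%:R / delta = 32 * T%:R * (K%:R / s) :> R.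
  by rewrite /delta; field; rewrite !gt_eqF.
have [//||//|z|z|z w zw|||Phi [h1 h2 h3]] := move_fibers base (ord_max : 'I_m.+1)
    (a%:~R + 2^-1) (a%:~R + 2^-1 + T%:R) s (3 / 8) delta
    (33 * T%:R ^+ 2 * K%:R / s ^+ 2)
    (fun z => upd (column z) ord_max (height z)) (fun z => q z ord_max).
- lra.
- exact: q_slab.
- rewrite updk; have /andP[? ?] := slab_lat_itv (R := R) z; have /andP[? ?] := height_itv z.
  have k0 : 0 < (8 * K%:R : R)^-1 by rewrite invr_gt0; lra.
  by apply/andP; split; lra.
- have [i [im hi]] := column_sep _ _ zw; exists i; split => //.
  by rewrite !(updN _ _ _ i).
- rewrite (addrC _ T%:R) addrK e1.
  rewrite (_ : 33 * _ * _ / _ = 33 * T%:R * ((K%:R / s) * (T%:R / s))); last first.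
    by field; rewrite gt_eqF.
  have t2 : 2 <= T%:R / s by rewrite ler_pdivlMr //; lra.
  have : (K%:R / s) * 2 <= (K%:R / s) * (T%:R / s) by rewrite ler_wpM2l //; lra.
  move: (K%:R / s) (_ * (T%:R / s)) y1 => Y Z y1 YZ.
  have : T%:R * 1 <= T%:R * Y by rewrite ler_wpM2l //; lra.
  have : T%:R * (Y * 2) <= T%:R * Z by rewrite ler_wpM2l //; lra.
  lra.
- rewrite (addrC _ T%:R) addrK e1.
  rewrite (_ : s / _ * _ = 33 * T%:R * (K%:R / s)); last by field; rewrite !gt_eqF //; lra.
  nra.
exists Phi; split => // z; rewrite h2 -column_last.
by apply: funext => i; rewrite /upd; case: eqP => [->|//].
Qed.

(** The supports have radius s/2, and perturbing by s/8 leaves the points at least 7s/4 apart. *)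
Lemma settle_step : exists Phi : pt R m.+1 -> pt R m.+1,
  [/\ sup_bilip Phi 2, forall z, Phi (column z) = q z &
      forall x, slab_out a T x -> Phi x = x].
Proof.
bounds.
have [|//|z i|z|x z w|Phi [h1 h2 h3]] :=
  move_points base (ord_max : 'I_m.+1) (s / 8) 0 column q.
- lra.
- by rewrite distrC column_near.
- by rewrite mul0r.
- have s8 : 0 < 4 * (s / 8) by lra.
  rewrite !mul0r !addr0 !ltr_pdivrMr //.
  move=> hz hw; apply: contrapT => /q_sep.
  have := supd_triangle (column z) (q z) (q w).
  have := supd_triangle (column w) (column z) (q w).
  have := supd_triangle x (column z) (column w).
  rewrite (supdC (q z) (column z)) (supdC (column z) x).
  have := column_supd z; have := column_supd w; lra.
exists Phi; split => //; first by move: h1; rewrite mulr0 addr0 mulr1.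
move=> x hx; apply: h3 => z; rewrite mul0r addr0 ler_pdivlMr; last lra.
have : s <= supd x (column z); last by lra.
by apply: slab_out_ge hx _; rewrite column_last.
Qed.

Lemma slab_extension_colored : exists H : pt R m.+1 -> pt R m.+1,
  [/\ sup_bilip H (2 ^+ 15 * D%:R * T%:R ^+ 2 * K%:R ^+ 2 / s ^+ 2),
      forall z, H (p z) = q z & forall x, slab_out a T x -> H x = x].
Proof.
bounds.
have [P1 [a1 b1 c1]] := lift_step; have [P2 [a2 b2 c2]] := shear_step.
have [P3 [a3 b3 c3]] := fiber_step; have [P4 [a4 b4 c4]] := settle_step.
exists (P4 \o (P3 \o (P2 \o P1))); split.
- have h0 : 0 <= 2 + 128 * D%:R * K%:R :> R.
    by rewrite addr_ge0 // !mulr_ge0 ?ler0n.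
  have h3 : 0 <= 33 * T%:R ^+ 2 * K%:R / s ^+ 2.
    by rewrite !mulr_ge0 ?ler0n ?exprn_ge0 ?ler0n // invr_ge0 exprn_ge0 // ltW.
  have h2 : 0 <= 2 :> R by [].
  have h12 := mulr_ge0 h0 h2; have h123 := mulr_ge0 h3 h12.
  apply: (sup_bilip_le _ (sup_bilip_comp h2 h123 a4
           (sup_bilip_comp h3 h12 a3 (sup_bilip_comp h0 h2 a2 a1)))).
  set Z := T%:R ^+ 2 * K%:R / s ^+ 2.
  have Z0 : 0 <= Z.
    by rewrite !mulr_ge0 ?ler0n ?exprn_ge0 ?ler0n // invr_ge0 exprn_ge0 // ltW.
  rewrite (_ : 2 * _ = (132 * (2 + 128 * (D%:R * K%:R))) * Z); last by rewrite /Z; ring.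
  rewrite (_ : 2 ^+ 15 * _ * _ * _ / _ = (2 ^+ 15 * (D%:R * K%:R)) * Z); last by rewrite /Z; ring.
  rewrite ler_wpM2r //.
  have : 1 <= D%:R * K%:R :> R by rewrite -natrM ler1n muln_gt0 D_gt0.
  rewrite (_ : 2 ^+ 15 = 2 * 128 * 128); last by ring.
  move: (D%:R * K%:R) => X; lra.
- by move=> z /=; rewrite b1 b2 b3 b4.
- by move=> x hx /=; rewrite c1 // c2 // c3 // c4.
Qed.

End SlabSteps.

Lemma slab_extension {R : realType} {m : nat} (a : int) (T D : nat) (s : R)
    (q : ('I_m.+1 -> int) -> pt R m.+1) :
  let inS (z : 'I_m.+1 -> int) := a < z ord_max <= a + T%:Z in
  (0 < m)%N -> (0 < T)%N -> (0 < D)%N -> 0 < s -> s <= 2^-1 ->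
  (forall z, inS z -> a%:~R + 2^-1 + s <= q z ord_max <= a%:~R + 2^-1 + T%:R - s) ->
  (forall z w, inS z -> inS w -> z <> w -> 2 * s <= supd (q z) (q w)) ->
  (forall z, inS z -> supd (emb z) (q z) <= D%:R) ->
  exists H : pt R m.+1 -> pt R m.+1,
    [/\ sup_bilip H (2 ^+ 15 * D%:R * T%:R ^+ 4 * (16 * D%:R) ^+ (2 * m) / s ^+ 2),
        forall z, inS z -> H (emb z) = q z &
        forall x, slab_out a T x -> H x = x].
Proof.
move=> inS m0 T0 D0 s0 s1 hq hsep hnear.
have W0 : (0 < 16 * D)%N by rewrite muln_gt0.
(* The modulus 16D is the horizontal gap used by the shear; it yields (16D)^m T colours. *)
have [col [colK colP]] := lattice_coloring m T (16 * D) a T0 W0.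
have K0 : (0 < (16 * D) ^ m * T)%N by rewrite muln_gt0 expn_gt0 W0.
have [//|//|//|//|//|//|z|z w zw|z|//|z w e zw|H [h1 h2 h3]] := slab_extension_colored a T D ((16 * D) ^ m * T) s
   (fun z : slab_lat a T => q (sval z)) (fun z => col (sval z)).
- exact: (hq _ (valP z)).
- apply: hsep; [exact: (valP z)|exact: (valP w)|].
  by case: z w zw => [z hz] [w hw] /= + e; apply; apply: eq_exist.
- exact: (hnear _ (valP z)).
- have zw' : sval z <> sval w.
    by case: z w zw {e} => [z hz] [w hw] /= + e; apply; apply: eq_exist.
  have [lst [i [im hi]]] := colP _ _ (valP z) (valP w) e zw'.
  split => //; exists i; split => //.
  by rewrite /emb -intrB -intr_norm -natrM -[_%:R]/((16 * D)%:Z%:~R) ler_int.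
exists H; split => //; last by move=> z hz; exact: (h2 (exist _ z hz)).
have e : T%:R ^+ 4 * (16 * D%:R) ^+ (2 * m) = T%:R ^+ 2 * ((16 * D) ^ m * T)%:R ^+ 2 :> R.
  rewrite !(natrM, natrX) (mulnC 2) exprM; move: (_ ^+ m) => X; ring.
by move: h1; rewrite -(mulrA _ (T%:R ^+ 2)) -e mulrA.
Qed.

(** * Gluing slabs *)

(** The point p is where the segment from x to y meets the hyperplane; distances add up along a
    segment. *)
Lemma supd_cross {R : realType} {n : nat} (k : 'I_n) (x y : pt R n) (c : R) :
  x k <= c <= y k -> exists p, p k = c /\ supd x p + supd p y <= supd x y.
Proof.
move=> /andP[xc cy]; have [e|ne] := eqVneq (x k) (y k).
  by exists x; rewrite supd_xx add0r; split => //; lra.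
have d0 : 0 < y k - x k by rewrite subr_gt0 lt_neqAle ne; lra.
pose t := (c - x k) / (y k - x k).
have t0 : 0 <= t by rewrite divr_ge0 //; lra.
have t1 : t <= 1 by rewrite ler_pdivrMr //; lra.
exists (fun i => x i + t * (y i - x i)); split.
  by rewrite /t divfK ?gt_eqF // addrC subrK.
have S0 := supd_ge0 x y.
rewrite [leRHS](_ : _ = t * supd x y + (1 - t) * supd x y); last by ring.
have t2 : 0 <= 1 - t by rewrite subr_ge0.
apply: lerD; (apply: supd_le => [|i]; first exact: mulr_ge0).
  rewrite /= (_ : _ - _ = t * (x i - y i)); last by ring.
  by rewrite normrM ger0_norm // ler_wpM2l ?coord_le_supd.
rewrite /= (_ : _ - _ = (1 - t) * (x i - y i)); last by ring.
by rewrite normrM ger0_norm // ler_wpM2l ?coord_le_supd.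
Qed.

(** If [H x] is outside, then [H] fixes [H x], and injectivity gives [H x = x]. *)
Lemma slab_stable {R : realType} {m : nat} (a : int) (T : nat) (C : R)
    (H : pt R m.+1 -> pt R m.+1) x :
  sup_bilip H C -> (forall x, slab_out a T x -> H x = x) ->
  a%:~R + 2^-1 <= x ord_max <= a%:~R + 2^-1 + T%:R ->
  a%:~R + 2^-1 <= H x ord_max <= a%:~R + 2^-1 + T%:R.
Proof.
move=> hH hid hx; have [/hid|nHx] := pselect (slab_out a T (H x)).
  by move/(sup_bilip_inj hH) => ->.
by apply/andP; split; rewrite leNgt; apply/negP => /ltW h; apply: nHx; [left|right].
Qed.

(** Points of different slabs are joined through a point of a separating hyperplane, which both maps
    fix. As distances add at this point, the constant C survives the gluing. *)
Lemma slab_glue {R : realType} {m : nat} (T : nat) (C : R)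
    (H : int -> pt R m.+1 -> pt R m.+1) :
  (0 < T)%N -> 0 <= C -> (forall k, sup_bilip (H k) C) ->
  (forall k x, slab_out (k * T%:Z) T x -> H k x = x) ->
  exists G, sup_bilip G C /\
    forall k x, ~ slab_out (k * T%:Z) T x -> G x = H k x.
Proof.
move=> T0 C0 hH hid; have T0R : 0 < T%:R :> R by rewrite ltr0n.
pose ix (x : pt R m.+1) := Num.floor ((x ord_max - 2^-1) / T%:R).
have cast k : (k * T%:Z)%:~R = k%:~R * T%:R :> R by rewrite intrM.
have ixP x : (ix x * T%:Z)%:~R + 2^-1 <= x ord_max <= (ix x * T%:Z)%:~R + 2^-1 + T%:R.
  have /andP[f1 f2] := floor_itv ((x ord_max - 2^-1) / T%:R).
  rewrite ler_pdivlMr // in f1; rewrite ltr_pdivrMr // intrD in f2.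
  by rewrite cast /ix; apply/andP; split; lra.
exists (fun x => H (ix x) x); split; last first.
  move=> k x hx; suff -> : ix x = k by [].
  apply: floor_def.
  rewrite intrD ler_pdivlMr // ltr_pdivrMr //.
  move: hx; rewrite /slab_out cast => hx.
  apply/andP; split; rewrite ?leNgt ?ltNge; apply/negP => h; apply: hx; [left|right]; lra.
suff key x y : ix x <= ix y ->
    supd (H (ix x) x) (H (ix y) y) <= C * supd x y /\
    supd x y <= C * supd (H (ix x) x) (H (ix y) y).
  move=> x y; case/orP: (le_total (ix x) (ix y)) => /key //.
  by rewrite (supdC y x) (supdC (H _ y)).
rewrite le_eqVlt => /orP[/eqP->|xy]; first exact: hH.
(* The level c is the lower boundary of the slab of y, which is at or above the upper boundary of
   the slab of x. *)
have [c cE] : exists c : R, c = (ix y * T%:Z)%:~R + 2^-1 by eexists.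
have xc : (ix x * T%:Z)%:~R + 2^-1 + T%:R <= c.
  rewrite cE !cast; have : (ix x)%:~R + 1 <= (ix y)%:~R :> R.
    by rewrite -[1]/(1%:~R) -intrD ler_int; lia.
  by move=> h; have := ler_wpM2r (ltW T0R) h; rewrite mulrDl mul1r; lra.
have outx (p : pt R m.+1) : p ord_max = c -> slab_out (ix x * T%:Z) T p by rewrite /slab_out => ->; right.
have outy (p : pt R m.+1) : p ord_max = c -> slab_out (ix y * T%:Z) T p by rewrite /slab_out => ->; left; rewrite cE.
have /andP[x1 x2] := ixP x; have /andP[y1 y2] := ixP y.
have /andP[u1 u2] := slab_stable _ _ _ _ _ (hH (ix x)) (hid (ix x)) (ixP x).
have /andP[v1 v2] := slab_stable _ _ _ _ _ (hH (ix y)) (hid (ix y)) (ixP y).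
split.
  have [|p [pc hp]] := supd_cross ord_max x y c; first by apply/andP; split; lra.
  apply: (le_trans (supd_triangle p _ _)).
  apply: le_trans (ler_wpM2l C0 hp); rewrite mulrDr lerD //.
    by have [+ _] := hH (ix x) x p; rewrite (hid _ _ (outx _ pc)).
  by have [+ _] := hH (ix y) p y; rewrite (hid _ _ (outy _ pc)).
(* For the lower bound the segment joins the images, which [slab_stable] has placed on the two sides
   of c. *)
have [|p [pc hp]] := supd_cross ord_max (H (ix x) x) (H (ix y) y) c.
  by apply/andP; split; lra.
apply: (le_trans (supd_triangle p _ _)).
apply: le_trans (ler_wpM2l C0 hp); rewrite mulrDr lerD //.
  by have [_ +] := hH (ix x) x p; rewrite (hid _ _ (outx _ pc)).
by have [_ +] := hH (ix y) p y; rewrite (hid _ _ (outy _ pc)).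
Qed.

(** * Extension from the lattice by composing with G *)

Lemma Ftilde_emb {R : realType} {d : nat} (f : ('I_d -> int) -> pt R d) G z :
  Ftilde f G (emb z) = f z.
Proof.
rewrite /Ftilde; case: asboolP => [_|[]]; last by exists z.
by congr f; apply: funext => i; rewrite /emb intrKfloor.
Qed.

Lemma Ftilde_hyperplane {R : realType} {m : nat} (f : ('I_m.+1 -> int) -> pt R m.+1) G
    (T : nat) p : hyperplanes m.+1 T p -> Ftilde f G p = G p.
Proof.
move=> [k /= hk]; rewrite /Ftilde; case: asboolP => // -[z ez]; exfalso.
move: hk; rewrite ez /emb => h.
have : (2 * (z ord_max - k * T%:Z))%:~R = 1%:~R :> R.
  by rewrite intrM intrB intrM h -[T%:Z%:~R]/(T%:R); field.
by move/(@intr_inj R); lia.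
Qed.

Lemma bilip_lattice_const_ge1 {R : realType} {m : nat} (A : set (pt R m.+1)) g (M : R) :
  (forall z, A (emb z)) -> bilip_on A g M -> 1 <= M.
Proof.
move=> hA hg; apply: (bilip_const_ge1 hg (hA (fun=> 0)) (hA (fun=> 1))).
by move/(congr1 (fun x : pt R m.+1 => x ord_max)); rewrite /emb => /eqP; rewrite eqr_int.
Qed.

(** The points [q z] are preimages of [f z] under [G] in the slab of z. On the hyperplanes [Ftilde]
    agrees with [G], so distances from z and from [q z] to points there are comparable up to M1 M2.
    This keeps [q z] off the boundary and near z. Separation comes from comparing f with [G], and
    the square root in s from passing to the sup distance. *)
Lemma slab_lattice_extension {R : realType} {m : nat} (f : ('I_m.+1 -> int) -> pt R m.+1)
    (T D : nat) (G : pt R m.+1 -> pt R m.+1) (M1 M2 : R) (k : int) :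
  let s := (2 * (M1 * M2 * Num.sqrt m.+1%:R))^-1 in
  let inS (z : 'I_m.+1 -> int) := k * T%:Z < z ord_max <= k * T%:Z + T%:Z in
  (0 < m)%N -> (0 < T)%N -> 2 * (M1 * M2 * T%:R) <= D%:R ->
  bilip_on setT G M2 -> bilip_on (Ftilde_dom m.+1 T) (Ftilde f G) M1 ->
  (forall z : 'I_m.+1 -> int, slab m.+1 T (k + 1) (emb z : pt R m.+1) ->
     exists x, slab m.+1 T (k + 1) x /\ G x = f z) ->
  exists H : pt R m.+1 -> pt R m.+1,
    [/\ sup_bilip H (2 ^+ 15 * D%:R * T%:R ^+ 4 * (16 * D%:R) ^+ (2 * m) / s ^+ 2),
        forall z, inS z -> G (H (emb z)) = f z &
        forall x, slab_out (k * T%:Z) T x -> H x = x].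
Proof.
move=> s inS m0 T0 hD hG hF hS.
have M1_ge1 : 1 <= M1 by apply: bilip_lattice_const_ge1 hF => z; left; exists z.
have M2_ge1 : 1 <= M2 by apply: bilip_lattice_const_ge1 hG.
have L1 : 1 <= M1 * M2 by rewrite mulr_ege1.
have M10 : 0 <= M1 by lra.
have M20 : 0 <= M2 by lra.
have T1 : 1 <= T%:R :> R by rewrite ler1n.
set n : R := Num.sqrt m.+1%:R in s *.
have n1 : 1 <= n by rewrite /n -[leLHS]sqrtr1 ler_wsqrtr // ler1n.
have D0 : (0 < D)%N.
  rewrite -(ltr_nat R); apply: lt_le_trans hD; rewrite mulr_gt0 // mulr_gt0 //; lra.
have Ln1 : 1 <= M1 * M2 * n by rewrite mulr_ege1.
have s0 : 0 < s by rewrite invr_gt0; lra.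
have s1 : s <= 2^-1 by rewrite lef_pV2 ?posrE; lra.
have castk : (k * T%:Z)%:~R = k%:~R * T%:R :> R by rewrite intrM.
have inS_R z : inS z ->
    k%:~R * T%:R + 1 <= (emb z ord_max : R) <= k%:~R * T%:R + T%:R.
  move=> /andP[h1 h2]; rewrite /emb -castk -[1]/(1%:~R) -[T%:R]/(T%:Z%:~R) -!intrD.
  rewrite !ler_int; clear -h1 h2; apply/andP; split; lia.
(* The slab with index k + 1 starts at height kT + 1/2; outside it [q] takes the default value 0. *)
have /choice[q hq] : forall z, exists x, inS z -> slab m.+1 T (k + 1) x /\ G x = f z.
  move=> z; have [hz|nz] := pselect (inS z); last by exists (fun=> 0).
  have [|x hx] := hS z; last by exists x.
  have /andP[? ?] := inS_R _ hz.
  by rewrite /slab /= addrK intrD mulrDl mul1r; apply/andP; split; lra.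
have q_slab z : inS z ->
    k%:~R * T%:R + 2^-1 <= q z ord_max <= k%:~R * T%:R + T%:R + 2^-1.
  by move=> /hq[+ _]; rewrite /slab /= addrK intrD mulrDl mul1r.
have Gq z : inS z -> G (q z) = f z by move=> /hq[].
have lat z : Ftilde_dom m.+1 T (emb z : pt R m.+1) by left; exists z.
have to_hyp z p : inS z -> hyperplanes m.+1 T p ->
    edist (emb z) p <= M1 * M2 * edist (q z) p /\
    edist (q z) p <= M1 * M2 * edist (emb z) p.
  move=> hz hp; have hp' : Ftilde_dom m.+1 T p by right.
  have [f1 f2] := bilip_onW hF _ _ (lat z) hp'.
  rewrite Ftilde_emb (Ftilde_hyperplane f G T) // -Gq // in f1 f2.
  have [g1 g2] := bilip_onW hG (q z) p I I.
  split; [apply: (le_trans f2)|apply: (le_trans g2)].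
    by rewrite -mulrA ler_wpM2l.
  by rewrite (mulrC M1) -mulrA ler_wpM2l.
have hyp_at x c (e : int) : c = e%:~R * T%:R + 2^-1 ->
    hyperplanes m.+1 T (upd x ord_max c : pt R m.+1).
  by move=> ->; exists e; rewrite /= updk.
have far_hyp z c (e : int) : inS z -> c = e%:~R * T%:R + 2^-1 ->
    2^-1 <= `|emb z ord_max - c| -> s <= `|q z ord_max - c|.
  (* Comparison with the foot of [q z] on the hyperplane, whose Euclidean distance from [q z] is
     purely vertical. *)
  move=> hz ec h; have [h1 _] := to_hyp _ _ hz (hyp_at (q z) _ _ ec).
  have := le_trans (coord_le_edist _ _ ord_max) h1; rewrite updk.
  rewrite (edist_last (q z) _ ord_max) ?updk; last by move=> j jm; rewrite updN.
  move=> h2; have h3 := le_trans h h2.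
  rewrite -(ler_pM2l (lt_le_trans ltr01 L1)); apply: le_trans h3.
  rewrite /s invfM mulrCA invfM [M1 * M2 * _]mulrA divff ?mul1r; last by rewrite gt_eqF //; lra.
  by rewrite ler_piMr ?invf_le1 //; lra.
have [//|//|//|//|//|z hz|z w hz hw zw|z hz|H [h1 h2 h3]] :=
    slab_extension (k * T%:Z) T D s q.
- have /andP[a1 a2] := inS_R _ hz; have /andP[b1 b2] := q_slab _ hz.
  have lo := far_hyp _ (k%:~R * T%:R + 2^-1) k hz erefl.
  have hi := far_hyp _ (k%:~R * T%:R + T%:R + 2^-1) (k + 1) hz.
  rewrite castk; apply/andP; split.
    have : s <= `|q z ord_max - (k%:~R * T%:R + 2^-1)|.
      by apply: lo; rewrite ger0_norm; lra.
    by rewrite ger0_norm; lra.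
  have : s <= `|q z ord_max - (k%:~R * T%:R + T%:R + 2^-1)|.
    by apply: hi; [rewrite intrD mulrDl mul1r|rewrite ler0_norm; lra].
  by rewrite ler0_norm; lra.
- have [f1 f2] := bilip_onW hF _ _ (lat z) (lat w).
  have [g1 g2] := bilip_onW hG (q z) (q w) I I.
  rewrite !Ftilde_emb -!Gq // in f1 f2.
  have [i hi] := emb_far (R := R) _ _ _ zw.
  have e1 : 1 <= M1 * (M2 * edist (q z) (q w)).
    apply: le_trans (ler_wpM2l M10 g1); apply: le_trans f2.
    exact: le_trans hi (coord_le_edist _ _ _).
  have e2 : 1 <= M1 * M2 * n * supd (q z) (q w).
    apply: (le_trans e1); rewrite mulrA -[leRHS]mulrA ler_wpM2l ?edist_le_supd //; lra.
  rewrite /s invfM mulrA divff ?mul1r ?gt_eqF // -[leLHS]mul1r ler_pdivrMr; last lra.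
  by rewrite mulrC.
- apply: supd_le => [|i]; first exact: ler0n.
  (* The foot of z on the lower hyperplane is within T of z and within M1 M2 T of [q z], so [q z] is
     within (M1 M2 + 1) T of z. *)
  pose c := k%:~R * T%:R + 2^-1 : R.
  have [_ hp] := to_hyp _ _ hz (hyp_at (emb z) c k erefl).
  have e : edist (emb z) (upd (emb z) ord_max c) <= T%:R.
    rewrite (edist_last _ _ ord_max) ?updk; last by move=> j jm; rewrite updN.
    by have /andP[? ?] := inS_R _ hz; rewrite ger0_norm /c; lra.
  have eL : M1 * M2 * edist (emb z) (upd (emb z) ord_max c) <= M1 * M2 * T%:R.
    by rewrite ler_wpM2l //; lra.
  have TL : T%:R <= M1 * M2 * T%:R by rewrite ler_peMl //; lra.
  have := coord_le_edist (q z) (upd (emb z) ord_max c) i.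
  have := coord_le_edist (emb z) (upd (emb z) ord_max c) i.
  have := ler_distD (upd (emb z) ord_max c i) (emb z i) (q z i).
  rewrite (distrC (q z i)); lra.
exists H; split => // z hz; first by rewrite h2 // Gq.
Qed.

Lemma lattice_extension {R : realType} {m : nat} (f : ('I_m.+1 -> int) -> pt R m.+1)
    (T D : nat) (G : pt R m.+1 -> pt R m.+1) (M1 M2 : R) :
  let s := (2 * (M1 * M2 * Num.sqrt m.+1%:R))^-1 in
  (0 < m)%N -> (0 < T)%N -> 2 * (M1 * M2 * T%:R) <= D%:R ->
  bilip_on setT G M2 -> bilip_on (Ftilde_dom m.+1 T) (Ftilde f G) M1 ->
  (forall (k : int) (z : 'I_m.+1 -> int), slab m.+1 T k (emb z : pt R m.+1) ->
     exists x, slab m.+1 T k x /\ G x = f z) ->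
  exists F : pt R m.+1 -> pt R m.+1, (forall z, F (emb z) = f z) /\
    bilip_on setT F (M2 * (Num.sqrt m.+1%:R *
      (2 ^+ 15 * D%:R * T%:R ^+ 4 * (16 * D%:R) ^+ (2 * m) / s ^+ 2))).
Proof.
move=> s m0 T0 hD hG hF hS; set C := (X in M2 * (_ * X)).
have C0 : 0 <= C.
  by rewrite divr_ge0 ?exprn_even_ge0 // !mulr_ge0 ?exprn_ge0 ?mulr_ge0 ?ler0n.
have M20 : 0 <= M2 by apply: (le_trans ler01); apply: bilip_lattice_const_ge1 hG.
have /choice[H hH] := fun k => slab_lattice_extension f T D G M1 M2 k m0 T0 hD hG hF (hS (k + 1)).
have [k|k|K [hK Kout]] := slab_glue T C H T0 C0.
- by have [] := hH k.
- by have [] := hH k.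
exists (G \o K); split.
  (* The shift by 1 is due to the levels of slab k being kT + 1, ..., kT + T. *)
  move=> z; pose k := ((z ord_max - 1) %/ T%:Z)%Z.
  have Tz : (0 < T%:Z) by lia.
  have hz : k * T%:Z < z ord_max <= k * T%:Z + T%:Z.
    have := divz_eq (z ord_max - 1) T%:Z; have := modz_ge0 (z ord_max - 1) (lt0r_neq0 Tz).
    have := ltz_pmod (z ord_max - 1) Tz; rewrite -/k; lia.
  have [_ <- // _] := hH k; rewrite /= (Kout k) //.
  have /andP[h1 h2] := slab_lat_itv (R := R) (exist _ z hz : slab_lat (k * T%:Z) T).
  by rewrite /slab_out /= in h1 h2 * => -[]; lra.
move=> x y _ _ xy; have [k1 k2] := sup_bilip_on C0 hK x y I I xy.
have [g1 g2] := bilip_onW hG (K x) (K y) I I.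
have P0 : 0 <= Num.sqrt m.+1%:R * C by rewrite mulr_ge0 ?sqrtr_ge0.
move: P0 k1 k2; move: (Num.sqrt _ * C) => P P0 k1 k2; split => /=.
  by apply: (le_trans g1); rewrite -mulrA ler_wpM2l.
by apply: (le_trans k2); rewrite (mulrC M2) -[leRHS]mulrA ler_wpM2l.
Qed.

(** * Crossing paths in the plane *)

Inductive dir := East | North | West | South.

(** Signed quarter turns, counterclockwise positive. The value 0 on opposite directions is a
    default: such pairs are excluded wherever turns are added. *)
Definition turn (a b : dir) : int :=
  match a, b with
  | East, North | North, West | West, South | South, East => 1
  | North, East | West, North | South, West | East, South => -1
  | _, _ => 0
  end.

Definition opposite (a b : dir) : bool :=
  match a, b with
  | East, West | West, East | North, South | South, North => true
  | _, _ => false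
  end.

(** Pairwise non-opposite directions take at most two values, and these are adjacent; there the turn
    is a difference of angles. *)
Lemma turn_square a b c e :
  ~~ opposite a b -> ~~ opposite a c -> ~~ opposite a e ->
  ~~ opposite b c -> ~~ opposite b e -> ~~ opposite c e ->
  turn a b + turn b c = turn a e + turn e c.
Proof. by case: a; case: b => //; case: c => //; case: e. Qed.

(** Once a direction is missing, the circle of directions is cut open and l is a lift of the
    angle. *)
Lemma turn_telescope (N : nat) (g : nat -> dir) (l : dir -> int) (bad : dir) :
  (forall a b, a <> bad -> b <> bad -> ~~ opposite a b -> turn a b = l b - l a) ->
  (forall j, (j <= N)%N -> g j <> bad) ->
  (forall j, (j < N)%N -> ~~ opposite (g j) (g j.+1)) ->
  \sum_(0 <= j < N) turn (g j) (g j.+1) = l (g N) - l (g 0%N).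
Proof.
move=> hl hg ho; rewrite -(telescope_sumr (fun j => l (g j))) //.
rewrite !big_nat; apply: eq_bigr => j /= jN.
by apply: hl; [apply: hg; exact: ltnW|exact: hg|exact: ho].
Qed.

(* A labelling of a grid by directions, neighbours never being opposite, has
   total turning zero around each cell, hence around the boundary; the four
   boundary conditions would force a full turn. *)
Lemma no_direction_labelling (N : nat) (lab : nat -> nat -> dir) :
  (forall i j i' j', (i <= N)%N -> (j <= N)%N -> (i' <= N)%N -> (j' <= N)%N ->
     (i <= i'.+1)%N -> (i' <= i.+1)%N -> (j <= j'.+1)%N -> (j' <= j.+1)%N ->
     ~~ opposite (lab i j) (lab i' j')) ->
  (forall i, (i <= N)%N -> lab i 0%N <> East) ->
  (forall i, (i <= N)%N -> lab i N <> West) ->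
  (forall j, (j <= N)%N -> lab 0%N j <> South) ->
  (forall j, (j <= N)%N -> lab N j <> North) -> False.
Proof.
move=> adj hW hE hS hN.
pose row i := \sum_(0 <= j < N) turn (lab i j) (lab i j.+1).
pose colm j := \sum_(0 <= i < N) turn (lab i j) (lab i.+1 j).
have rowS i : (i < N)%N ->
    row i.+1 - row i = turn (lab i N) (lab i.+1 N) - turn (lab i 0%N) (lab i.+1 0%N).
  move=> iN; rewrite /row -sumrB -(telescope_sumr (fun j => turn (lab i j) (lab i.+1 j))) //.
  rewrite !big_nat; apply: eq_bigr => j /= jN.
  have : turn (lab i j) (lab i j.+1) + turn (lab i j.+1) (lab i.+1 j.+1) =
         turn (lab i j) (lab i.+1 j) + turn (lab i.+1 j) (lab i.+1 j.+1).
    by apply: turn_square; apply: adj; lia.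
  lia.
have rowN : row N - row 0%N = colm N - colm 0%N.
  rewrite -(telescope_sumr row) // /colm -sumrB !big_nat.
  by apply: eq_bigr => i /= iN; exact: rowS.
(* Angles in quarter turns, each lift cut at the direction missing on its side. At three corners the
   two lifts that meet agree on the admissible directions; at the corner (0,0) they differ by 4, a
   full turn. *)
pose l0 e : int := match e with North => 1 | West => 2 | _ => 0 end.
pose lN e : int := match e with North => 1 | South => -1 | _ => 0 end.
pose l1 e : int := match e with West => -2 | South => -1 | _ => 0 end.
pose l3 e : int := match e with North => -3 | West => -2 | South => -1 | _ => 0 end.
have r0 : row 0%N = l0 (lab 0%N N) - l0 (lab 0%N 0%N).
  apply: (turn_telescope _ _ _ South) => [[] [] //|j jN|j jN]; first exact: hS.
  by apply: adj; lia.
have rN : row N = l1 (lab N N) - l1 (lab N 0%N).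
  apply: (turn_telescope _ _ _ North) => [[] [] //|j jN|j jN]; first exact: hN.
  by apply: adj; lia.
have c0 : colm 0%N = l3 (lab N 0%N) - l3 (lab 0%N 0%N).
  apply: (turn_telescope _ (fun i => lab i 0%N) _ East) => [[] [] //|j jN|j jN]; first exact: hW.
  by apply: adj; lia.
have cN : colm N = lN (lab N N) - lN (lab 0%N N).
  apply: (turn_telescope _ (fun i => lab i N) _ West) => [[] [] //|j jN|j jN]; first exact: hE.
  by apply: adj; lia.
move: rowN; rewrite r0 rN c0 cN.
have := hW 0%N isT; have := hS 0%N isT; have := hW N (leqnn N); have := hN 0%N isT.
have := hE 0%N isT; have := hS N (leqnn N); have := hE N (leqnn N); have := hN N (leqnn N).
case: (lab N N) => // _; case: (lab 0%N N) => // _ _; case: (lab N 0%N) => // _ _ _;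
  by case: (lab 0%N 0%N).
Qed.

Definition grid {R : realType} (a b : R) (N i : nat) : R := a + i%:R * ((b - a) / N%:R).

Lemma grid_itv {R : realType} (a b : R) (N i : nat) :
  a <= b -> (0 < N)%N -> (i <= N)%N -> a <= grid a b N i <= b.
Proof.
move=> ab N0 iN; have N0R : 0 < N%:R :> R by rewrite ltr0n.
have q0 : 0 <= (b - a) / N%:R by rewrite divr_ge0 // ?subr_ge0 // ltW.
have qN : N%:R * ((b - a) / N%:R) = b - a by rewrite mulrC divfK // gt_eqF.
have h0 : 0 <= i%:R * ((b - a) / N%:R) by rewrite mulr_ge0.
have h1 : i%:R * ((b - a) / N%:R) <= N%:R * ((b - a) / N%:R) by rewrite ler_wpM2r // ler_nat.
by rewrite /grid; apply/andP; split; lra.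
Qed.

Lemma grid_step {R : realType} (a b : R) (N i j : nat) :
  a <= b -> (i <= j.+1)%N -> (j <= i.+1)%N ->
  `|grid a b N i - grid a b N j| <= (b - a) / N%:R.
Proof.
move=> ab ij ji; have q0 : 0 <= (b - a) / N%:R by rewrite divr_ge0 // subr_ge0.
rewrite /grid opprD addrACA subrr add0r -mulrBl normrM (ger0_norm q0) ler_piMl //.
have : i%:R <= j%:R + 1 :> R by rewrite -[1]/(1%:R) -natrD ler_nat addn1.
have : j%:R <= i%:R + 1 :> R by rewrite -[1]/(1%:R) -natrD ler_nat addn1.
by move: (i%:R) (j%:R) => u v ? ?; rewrite ler_norml; apply/andP; split; lra.
Qed.

(* Planar Poincare-Miranda theorem; the explicit gap [eps] and Lipschitz constant
   replace a compactness argument by a grid of mesh of order [eps / Lam]. *)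
Lemma no_miranda {R : realType} (f1 f2 : R -> R -> R) (s0 s1 t0 t1 Lam eps : R) :
  s0 <= s1 -> t0 <= t1 -> 0 <= Lam -> 0 < eps ->
  (forall s t s' t', `|f1 s t - f1 s' t'| <= Lam * (`|s - s'| + `|t - t'|)) ->
  (forall s t s' t', `|f2 s t - f2 s' t'| <= Lam * (`|s - s'| + `|t - t'|)) ->
  (forall s t, s0 <= s <= s1 -> t0 <= t <= t1 -> eps <= `|f1 s t| \/ eps <= `|f2 s t|) ->
  (forall s, s0 <= s <= s1 -> f1 s t0 <= 0) ->
  (forall s, s0 <= s <= s1 -> 0 <= f1 s t1) ->
  (forall t, t0 <= t <= t1 -> 0 <= f2 s0 t) ->
  (forall t, t0 <= t <= t1 -> f2 s1 t <= 0) -> False.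
Proof.
move=> s01 t01 Lam0 eps0 lip1 lip2 big ht0 ht1 hs0 hs1.
pose W := Lam * ((s1 - s0) + (t1 - t0)).
have W0 : 0 <= W by rewrite mulr_ge0 // addr_ge0 // subr_ge0.
pose N := (Num.truncn (W / eps)).+1.
have N0 : 0 < N%:R :> R by rewrite ltr0n.
have WN : W / N%:R < eps.
  by rewrite ltr_pdivrMr // mulrC -ltr_pdivrMr // truncnS_gt // divr_ge0 // ltW.
have N1 : (0 < N)%N by [].
pose F1 i j := f1 (grid s0 s1 N i) (grid t0 t1 N j).
pose F2 i j := f2 (grid s0 s1 N i) (grid t0 t1 N j).
have gs i : (i <= N)%N -> s0 <= grid s0 s1 N i <= s1 by move=> ?; exact: grid_itv.
have gt j : (j <= N)%N -> t0 <= grid t0 t1 N j <= t1 by move=> ?; exact: grid_itv.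
have near (f : R -> R -> R) i j i' j' :
    (forall s t s' t', `|f s t - f s' t'| <= Lam * (`|s - s'| + `|t - t'|)) ->
    (i <= i'.+1)%N -> (i' <= i.+1)%N -> (j <= j'.+1)%N -> (j' <= j.+1)%N ->
    `|f (grid s0 s1 N i) (grid t0 t1 N j) - f (grid s0 s1 N i') (grid t0 t1 N j')| < eps.
  move=> lip h1 h2 h3 h4; apply: le_lt_trans WN; apply: (le_trans (lip _ _ _ _)).
  rewrite /W -mulrA ler_wpM2l // mulrDl lerD //; exact: grid_step.
have [g0 gN] : grid s0 s1 N 0 = s0 /\ grid s0 s1 N N = s1.
  by rewrite /grid mul0r addr0 mulrC divfK ?gt_eqF // addrC subrK.
have [k0 kN] : grid t0 t1 N 0 = t0 /\ grid t0 t1 N N = t1.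
  by rewrite /grid mul0r addr0 mulrC divfK ?gt_eqF // addrC subrK.
(* The label is a dominant direction of the vector (f1, f2). Opposite labels at neighbours would
   need a change of at least 2 eps in one component, whereas the mesh allows less than eps. *)
pose lab i j := if eps <= F1 i j then East else if F1 i j <= - eps then West
                else if eps <= F2 i j then North else South.
have labP i j : (i <= N)%N -> (j <= N)%N ->
    match lab i j with
    | East => eps <= F1 i j | West => F1 i j <= - eps
    | North => eps <= F2 i j | South => F2 i j <= - eps
    end.
  move=> iN jN; rewrite /lab; do 3 case: ifPn => //.
  rewrite -!ltNge => x1 x2 x3; have [] := big _ _ (gs _ iN) (gt _ jN).
    by rewrite -/(F1 i j) ler_normr => /orP[]; lra.
  by rewrite -/(F2 i j) ler_normr => /orP[]; lra.
apply: (no_direction_labelling N lab) => [i j i' j' iN jN iN' jN' h1 h2 h3 h4|i iN|i iN|j jN|j jN].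
- have := near f1 i j i' j' lip1 h1 h2 h3 h4; have := near f2 i j i' j' lip2 h1 h2 h3 h4.
  rewrite -/(F1 i j) -/(F2 i j) -/(F1 i' j') -/(F2 i' j') !ltr_norml => /andP[? ?] /andP[? ?].
  have := labP _ _ iN jN; have := labP _ _ iN' jN'.
  by case: (lab i j); case: (lab i' j') => //= *; exfalso; lra.
- move=> e; have := labP i 0%N iN isT; rewrite e /F1 k0; have := ht0 _ (gs _ iN); lra.
- move=> e; have := labP i N iN (leqnn N); rewrite e /F1 kN; have := ht1 _ (gs _ iN); lra.
- move=> e; have := labP 0%N j isT jN; rewrite e /F2 g0; have := hs0 _ (gt _ jN); lra.
- move=> e; have := labP N j (leqnn N) jN; rewrite e /F2 gN; have := hs1 _ (gt _ jN); lra.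
Qed.

Definition pt2 {R : realType} (x y : R) : pt R 2 := fun i => if i == ord0 then x else y.

Lemma edist_pt2_snd {R : realType} (x y y' : R) : edist (pt2 x y) (pt2 x y') = `|y - y'|.
Proof.
rewrite (edist_last _ _ ord_max) // => j jm; rewrite /pt2.
by have -> : j == ord0 by case: j jm => [[|[|j]] hj].
Qed.

Lemma edist_pt2_fst {R : realType} (x y x' y' : R) : `|x - x'| <= edist (pt2 x y) (pt2 x' y').
Proof. exact: (coord_le_edist (pt2 x y) (pt2 x' y') ord0). Qed.

Lemma edist_pt2_le {R : realType} (p p' : pt R 2) :
  edist p p' <= `|p ord0 - p' ord0| + `|p ord_max - p' ord_max|.
Proof.
rewrite /edist big_ord_recl big_ord1.
have -> : lift ord0 ord0 = ord_max :> 'I_2 by apply: val_inj.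
rewrite (distrC (p ord0)) (distrC (p ord_max)) -[leRHS]ger0_norm ?addr_ge0 // -sqrtr_sqr.
apply: ler_wsqrtr; rewrite -[X in X + _]real_normK ?num_real // -[X in _ + X]real_normK ?num_real //.
have := normr_ge0 (p' ord0 - p ord0); have := normr_ge0 (p' ord_max - p ord_max); nra.
Qed.

(* The vertical segment through the origin is mapped to a path from (0,1/2) to
   (0,-1/2) through (n,0).  If L < 2n+1 it is too short to reach the ray
   {x <= 0, y = 0}, so it cannot cross the concatenation of this ray, the image
   of {n} x [0,1/2] (a path from the origin to (n,1/2)) and a horizontal ray:
   this contradicts planarity. *)
Lemma planar_swap_bound {R : realType} (L n : R) (U : pt R 2 -> pt R 2) :
  1 <= n -> bilip_on setT U L ->
  (forall x, ~ (- 2^-1 < lastc x < 2^-1) -> U x = x) ->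
  U (pt2 0 0) = pt2 n 0 -> U (pt2 n 0) = pt2 0 0 -> 2 * n + 1 <= L.
Proof.
move=> n1 hU hid U0 Un; rewrite leNgt; apply/negP => Ln.
have L1 : 1 <= L.
  apply: (bilip_const_ge1 hU (x := pt2 0 0) (y := pt2 n 0)) => // e.
  by have := congr1 (fun p : pt R 2 => p ord0) e; rewrite /pt2 /=; lra.
have lip x y y' i : `|U (pt2 x y) i - U (pt2 x y') i| <= L * `|y - y'|.
  apply: (le_trans (coord_le_edist _ _ _)); rewrite -(edist_pt2_snd x).
  exact: (bilip_onW hU _ _ I I).1.
have sep x y x' y' : `|x - x'| <= L * (`|U (pt2 x y) ord0 - U (pt2 x' y') ord0| +
                                    `|U (pt2 x y) ord_max - U (pt2 x' y') ord_max|).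
  apply: (le_trans (edist_pt2_fst _ y _ y')).
  apply: (le_trans (bilip_onW hU _ _ I I).2); rewrite ler_wpM2l ?edist_pt2_le //; lra.
have fixU x y : ~ (- 2^-1 < y < 2^-1) -> U (pt2 x y) = pt2 x y by move=> h; apply: hid.
have top x : U (pt2 x 2^-1) = pt2 x 2^-1.
  by apply: fixU => /andP[_]; rewrite ltxx.
have bot x : U (pt2 x (- 2^-1)) = pt2 x (- 2^-1).
  by apply: fixU => /andP[]; rewrite ltxx.
have Uinj p p' : U p = U p' -> p = p'.
  by move=> e; apply: edist_eq0; have [_] := bilip_onW hU p p' I I; rewrite e edist_xx mulr0.
have strip x y : - 2^-1 <= y <= 2^-1 -> - 2^-1 <= U (pt2 x y) ord_max <= 2^-1.
  move=> hy; have [h|h] := pselect (- 2^-1 < lastc (U (pt2 x y)) < 2^-1).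
    by move: h => /andP[h1 h2]; rewrite (ltW h1) (ltW h2).
  by have /Uinj-> := hid _ h.
pose cl (t : R) := if t <= 0 then 0 else if t <= 2^-1 then t else 2^-1.
have clP t : [\/ t <= 0 /\ cl t = 0, 0 <= t <= 2^-1 /\ cl t = t | 2^-1 <= t /\ cl t = 2^-1].
  rewrite /cl; case: ifPn => [?|]; first by constructor 1.
  rewrite -ltNge => /ltW t0; case: ifPn => [?|]; first by constructor 2; rewrite t0.
  by rewrite -ltNge => /ltW ?; constructor 3.
have cl_itv t : 0 <= cl t <= 2^-1.
  by case: (clP t) => -[? ->]; apply/andP; split; lra.
have cl_lip t t' : `|cl t - cl t'| <= `|t - t'|.
  have h1 := ler_norm (t - t'); have h2 := ler_norm (t' - t).
  rewrite (distrC t' t) in h2; rewrite ler_norml.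
  by case: (clP t) => -[+ ->]; case: (clP t') => -[+ ->] => *; apply/andP; split; lra.
(* The first bound keeps the short path away from the ray; the second keeps images of points whose
   first coordinates differ by at least n more than eps apart. *)
pose eps := Num.min ((2 * n + 1 - L) / 8) (n / (4 * L)).
have [eps0 epsL epsn] : [/\ 0 < eps, 8 * eps <= 2 * n + 1 - L & 4 * (L * eps) <= n].
  have p1 : 0 < (2 * n + 1 - L) / 8 by lra.
  have p2 : 0 < n / (4 * L) by rewrite divr_gt0; lra.
  have e2 : eps <= n / (4 * L) by rewrite /eps ge_min lexx orbT.
  split; first by rewrite /eps lt_min p1.
    have : eps <= (2 * n + 1 - L) / 8 by rewrite /eps ge_min lexx.
    lra.
  by move: e2; rewrite ler_pdivlMr; lra.
pose A (i : 'I_2) (s : R) := U (pt2 0 s) i.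
(* The concatenated path: the ray (t,0) for t <= 0, the image of (n,t) for t in [0,1/2], the ray (n
   + t - 1/2, 1/2) afterwards. The clamp [cl] puts all three into one formula. *)
pose C1 t := U (pt2 n (cl t)) ord0 + (t - cl t).
pose C2 t := U (pt2 n (cl t)) ord_max.
have A_lip i s s' : `|A i s - A i s'| <= L * `|s - s'| by exact: lip.
have C2_lip t t' : `|C2 t - C2 t'| <= L * `|t - t'|.
  by apply: (le_trans (lip _ _ _ _)); rewrite ler_wpM2l //; lra.
have C1_lip t t' : `|C1 t - C1 t'| <= (L + 2) * `|t - t'|.
  have h : `|U (pt2 n (cl t)) ord0 - U (pt2 n (cl t')) ord0| <= L * `|t - t'|.
    by apply: (le_trans (lip _ _ _ _)); rewrite ler_wpM2l //; lra.
  have h' := cl_lip t t'; have d1 := ler_norm (t - t'); have d2 := ler_norm (t' - t).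
  rewrite (distrC t' t) in d2; move: h h'; rewrite /C1 !ler_norml => /andP[? ?] /andP[? ?].
  by apply/andP; split; lra.
have A0 i s : `|A i s - pt2 n 0 i| <= L * `|s|.
  by have := lip 0 s 0 i; rewrite U0 subr0.
(* The path [A] has first coordinate within L/2 of n, so the range of t is long enough for [C1] to
   start to the left and finish to the right of it. *)
apply: (no_miranda (fun s t => C1 t - A ord0 s) (fun s t => C2 t - A ord_max s)
          (- 2^-1) (2^-1) (- L) (L + 2^-1) (L + 2) eps) => //; try lra.
- move=> s t s' t'; have := A_lip ord0 s s'; have := C1_lip t t'.
  have := normr_ge0 (s - s'); have := normr_ge0 (t - t').
  rewrite !ler_norml => ? ? /andP[? ?] /andP[? ?]; apply/andP; split; lra.
- move=> s t s' t'; have := A_lip ord_max s s'; have := C2_lip t t'.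
  have := normr_ge0 (s - s'); have := normr_ge0 (t - t').
  rewrite !ler_norml => ? ? /andP[? ?] /andP[? ?]; apply/andP; split; lra.
- move=> s t /andP[s_lo s_hi] ht; apply/orP; rewrite -[_ || _]negbK negb_or -!ltNge.
  apply/negP => /andP[d1 d2].
  case: (clP t) => -[tt ct]; rewrite /C1 /C2 ct in d1 d2.
  (* Near the ray, [A] has travelled n - eps horizontally from (n,0) and still has to travel 1/2 -
     eps vertically to an endpoint. Its half-length is at most L/2, so L > 2n + 1 - 4 eps. *)
  + rewrite Un /pt2 /= in d1 d2.
    have h0 := A0 ord0 s; rewrite /pt2 /= in h0.
    move: d1 d2; rewrite !ltr_norml => /andP[? ?] /andP[? ?].
    case/orP: (le_total 0 s) => s0.
      have := A_lip ord_max (2^-1) s; rewrite {1}/A top /pt2 /=.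
      rewrite (ger0_norm (_ : 0 <= 2^-1 - s)) ?subr_ge0 //.
      move: h0; rewrite (ger0_norm s0) !ler_norml => /andP[? ?] /andP[? ?]; lra.
    have := A_lip ord_max s (- 2^-1); rewrite {2}/A bot /pt2 /=.
    rewrite (ger0_norm (_ : 0 <= s - - 2^-1)) ?subr_ge0 //.
    move: h0; rewrite (ler0_norm s0) !ler_norml => /andP[? ?] /andP[? ?]; lra.
  + have := sep n t 0 s; rewrite subr0 ger0_norm; last lra.
    rewrite subrr addr0 in d1; have : L * (eps + eps) <= n / 2 by lra.
    move=> h1 h2; have : L * (`|U (pt2 n t) ord0 - U (pt2 0 s) ord0| +
       `|U (pt2 n t) ord_max - U (pt2 0 s) ord_max|) <= L * (eps + eps).
      by rewrite ler_wpM2l ?lerD ?ltW //; lra.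
    lra.
  (* The points of this ray are fixed by U, so they are images of points with first coordinate at
     least n. *)
  + have := sep (n + (t - 2^-1)) (2^-1) 0 s; rewrite subr0 ger0_norm; last lra.
    rewrite !top /pt2 /= in d1 d2 *; have : L * (eps + eps) <= n / 2 by lra.
    move=> h1 h2; have : L * (`|n + (t - 2^-1) - U (pt2 0 s) ord0| +
       `|2^-1 - U (pt2 0 s) ord_max|) <= L * (eps + eps).
      by rewrite ler_wpM2l ?lerD ?ltW //; lra.
    move: h2; rewrite /pt2 /=; lra.
- move=> s hs; case: (clP (- L)) => -[tt ct]; rewrite /C1 ct; try lra.
  rewrite Un /pt2 /=; have := A0 ord0 s; rewrite /pt2 /= ler_norml => /andP[? ?].
  have : L * `|s| <= L * 2^-1 by rewrite ler_wpM2l ?ler_norml //; lra.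
  lra.
- move=> s hs; case: (clP (L + 2^-1)) => -[tt ct]; rewrite /C1 ct; try lra.
  rewrite top /pt2 /=; have := A0 ord0 s; rewrite /pt2 /= ler_norml => /andP[? ?].
  have : L * `|s| <= L * 2^-1 by rewrite ler_wpM2l ?ler_norml //; lra.
  lra.
- move=> t _; rewrite /A bot /pt2 /C2 /=.
  have /andP[c0 c1] := cl_itv t; have /andP[? ?] : - 2^-1 <= U (pt2 n (cl t)) ord_max <= 2^-1.
    by apply: strip; apply/andP; split; lra.
  lra.
- move=> t _; rewrite /A top /pt2 /C2 /=.
  have /andP[c0 c1] := cl_itv t; have /andP[? ?] : - 2^-1 <= U (pt2 n (cl t)) ord_max <= 2^-1.
    by apply: strip; apply/andP; split; lra.
  lra.
Qed.

(** * Bounds for beta *)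

Lemma ext0_max {R : realType} {m : nat} (y : pt R m) : @ext0 R m.+1 y ord_max = 0.
Proof. by rewrite /ext0 insubF //= ltnn. Qed.

Lemma ext0_widen {R : realType} {m : nat} (y : pt R m) (i : 'I_m) :
  @ext0 R m.+1 y (widen_ord (leqnSn m) i) = y i.
Proof. by rewrite /ext0 /= valK. Qed.

Lemma ord_max_or_widen {m : nat} (i : 'I_m.+1) :
  i = ord_max \/ exists j, i = widen_ord (leqnSn m) j.
Proof.
have [im|im] := ltnP i m; last by left; apply: val_inj; have := ltn_ord i; rewrite /=; lia.
by right; exists (Ordinal im); apply: val_inj.
Qed.

(** The faces of the closed blocks have half-integer coordinates, so no lattice point is shared;
    doubling reduces the comparison to integers. *)
Lemma block_emb {R : realType} {m : nat} (S : nat) (z y : 'I_m -> int) :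
  block S z (emb y : pt R m) <->
  forall i, S%:Z * z i <= y i <= S%:Z * z i + S%:Z - 1.
Proof.
have half (u v : int) : (- 2^-1 + u%:~R <= v%:~R :> R) = (u <= v).
  apply/idP/idP => h; last by have : u%:~R <= v%:~R :> R by [rewrite ler_int]; lra.
  have : 2 * u%:~R - 1 <= 2 * v%:~R :> R by lra.
  by rewrite -!(intrM _ 2) -(intrB _ _ 1) ler_int; lia.
have half' (u v : int) : (v%:~R <= - 2^-1 + u%:~R :> R) = (v <= u - 1).
  apply/idP/idP => h; last first.
    by have : v%:~R <= (u - 1)%:~R :> R by [rewrite ler_int]; rewrite intrB; lra.
  have : 2 * v%:~R <= 2 * u%:~R - 1 :> R by lra.
  by rewrite -!(intrM _ 2) -(intrB _ _ 1) ler_int; lia.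
have e i : (- 2^-1 + S%:R * (z i)%:~R <= (y i)%:~R :> R) &&
     ((y i)%:~R <= - 2^-1 + S%:R * (z i)%:~R + S%:R :> R) =
    (S%:Z * z i <= y i <= S%:Z * z i + S%:Z - 1).
  by rewrite -half -half' intrD intrM addrA.
by split => h i; have := h i; rewrite /emb e.
Qed.

(** The constant of [slab_extension] for T = 1 and s = 1/2, with polynomial factors absorbed through
    k < 2^k. *)
Lemma beta_upper_const {R : realType} (m D : nat) : (0 < m)%N -> (0 < D)%N ->
  Num.sqrt m.+1%:R * (2 ^+ 15 * D%:R * 1%:R ^+ 4 * (16 * D%:R) ^+ (2 * m) / 2^-1 ^+ 2)
    <= 2 ^+ (8 * m.+1 * D.+1) :> R.
Proof.
move=> m0 D0.
have h2 k : 0 <= 2 ^+ k :> R by rewrite exprn_ge0.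
have e1 : Num.sqrt m.+1%:R <= 2 ^+ m :> R.
  apply: (@le_trans _ _ (m.+1%:R)); last by rewrite -natrX ler_nat ltn_expl.
  have n1 : 1 <= m.+1%:R :> R by rewrite ler1n.
  have := sqr_sqrtr (ler0n R m.+1); have := sqrtr_ge0 (m.+1%:R : R).
  move: (Num.sqrt _) => r; nra.
have e2 : D%:R <= 2 ^+ D.-1 :> R.
  by rewrite -natrX ler_nat -{1}(prednK D0) ltn_expl.
have e3 : (16 * D%:R) ^+ (2 * m) <= 2 ^+ ((D + 3) * (2 * m)) :> R.
  rewrite [leRHS]exprM lerXn2r ?nnegrE ?mulr_ge0 ?ler0n //.
  have -> : (D + 3 = 4 + D.-1)%N by lia.
  rewrite exprD (_ : 2 ^+ 4 = 16); last by ring.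
  by rewrite ler_wpM2l.
have e4 : (2^-1 ^+ 2)^-1 = 2 ^+ 2 :> R by rewrite exprVn invrK.
rewrite expr1n mulr1 e4.
apply: (@le_trans _ _ (2 ^+ m * (2 ^+ 15 * 2 ^+ D.-1 * 2 ^+ ((D + 3) * (2 * m)) * 2 ^+ 2))).
  rewrite ler_pM ?sqrtr_ge0 ?mulr_ge0 ?exprn_ge0 ?mulr_ge0 ?ler0n //.
  by rewrite ler_wpM2r // ler_pM ?mulr_ge0 ?exprn_ge0 ?mulr_ge0 ?ler0n // ler_wpM2l.
rewrite -!exprD; apply: ler_weXn2l; [lra|nia].
Qed.

(** A block permutation displaces points by at most S - 1 in each coordinate, so it is realised in
    the single-level slab between heights -1/2 and 1/2 (a = -1, T = 1, D = S - 1). For S = 1 it is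
    the identity. *)
Lemma F_class_pow {R : realType} {m : nat} : (0 < m)%N ->
  F_class m.+1 (fun t : R => powR 2 (8 * m.+1%:R * t)).
Proof.
move=> m0; have n0 : 0 <= 8 * m.+1%:R :> R by rewrite mulr_ge0.
have p2 (x : R) : 0 <= x -> 1 <= powR 2 x.
  by move=> x0; rewrite -[leLHS](powRr0 2) ler_powR // ler1n.
split; [|split].
- by move=> t t1; apply: p2; rewrite mulr_ge0 //; lra.
- by move=> s t s1 st; rewrite ler_powR ?ler1n // ler_wpM2l.
move=> S sigma S1 bij hblock _.
have powE : powR 2 (8 * m.+1%:R * S%:R) = 2 ^+ (8 * m.+1 * S) :> R.
  by rewrite -!natrM powR_mulrn.
have stay y i : `|y i - sigma y i| <= S%:Z - 1.
  pose z i := (y i %/ S%:Z)%Z.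
  have hy : block S z (emb y : pt R m).
    apply/block_emb => j; rewrite /z; have Sz : (S%:Z != 0) by lia.
    have := divz_eq (y j) S%:Z; have := modz_ge0 (y j) Sz.
    have := ltz_pmod (y j) (_ : 0 < S%:Z); rewrite mulrC => /(_ ltac:(lia)); lia.
  have /block_emb/(_ i) := hy; have /block_emb/(_ i) := hblock _ _ hy.
  by move: (S%:Z * z i) => a /andP[? ?] /andP[? ?]; lia.
have [S_eq1|S_gt1] := leqP S 1.
  exists id; split; [|split] => //.
    move=> x y _ _ _; have := p2 _ (mulr_ge0 n0 (ler0n R S)); have := edist_ge0 x y.
    by split; rewrite ler_peMl.
  move=> y; congr (ext0 (emb _)); apply: funext => i.
  by have := stay y i; lia.
pose rst (z : 'I_m.+1 -> int) : 'I_m -> int := fun i => z (widen_ord (leqnSn m) i).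
pose q z : pt R m.+1 := @ext0 R m.+1 (emb (sigma (rst z))).
have flat (z : 'I_m.+1 -> int) : (-1 : int) < z ord_max <= -1 + 1%:Z -> z ord_max = 0 by move=> /andP[? ?]; lia.
have emb_rst (z : 'I_m.+1 -> int) : z ord_max = 0 -> emb z = @ext0 R m.+1 (emb (rst z)).
  move=> z0; apply: funext => i; case: (ord_max_or_widen i) => [->|[j ->]].
    by rewrite ext0_max /emb z0.
  by rewrite ext0_widen.
have [//|//|||//|z hz|z w hz hw zw|z hz|H [h1 h2 h3]] := slab_extension (-1) 1 S.-1 (2^-1 : R) q.
- by rewrite -ltnS prednK // ltnW.
- by rewrite invr_gt0.
- by rewrite /q ext0_max; apply/andP; split; lra.
- rewrite divff ?pnatr_eq0 //.
  have rzw : sigma (rst z) <> sigma (rst w).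
    move=> /(bij_inj bij) e; apply: zw; apply: funext => i.
    case: (ord_max_or_widen i) => [->|[j ->]]; first by rewrite (flat _ hz) (flat _ hw).
    exact: (congr1 (fun f => f j) e).
  have [j hj] := emb_far (R := R) _ _ _ rzw; apply: le_trans hj _.
  by have := coord_le_supd (q z) (q w) (widen_ord (leqnSn m) j); rewrite /q !ext0_widen.
- rewrite (emb_rst z (flat _ hz)) /q; apply: supd_le => [|i]; first exact: ler0n.
  case: (ord_max_or_widen i) => [->|[j ->]]; first by rewrite !ext0_max subrr normr0.
  rewrite !ext0_widen /emb -intrB -intr_norm -[_%:R]/(_%:Z%:~R) ler_int.
  by have := stay (rst z) j; lia.
exists H; split; [|split].
- move=> x y _ _ xy; have C0 : 0 <= 2 ^+ 15 * S.-1%:R * 1%:R ^+ 4 *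
      (16 * S.-1%:R) ^+ (2 * m) / 2^-1 ^+ 2 :> R.
    by rewrite divr_ge0 ?exprn_ge0 ?invr_ge0 // !mulr_ge0 ?exprn_ge0 ?mulr_ge0 ?ler0n.
  have [b1 b2] := sup_bilip_on C0 h1 x y I I xy.
  have S0 : (0 < S.-1)%N by rewrite -ltnS prednK // ltnW.
  have := beta_upper_const (R := R) m _ m0 S0; rewrite prednK ?(ltnW S_gt1) // -powE => cc.
  by split; [apply: (le_trans b1)|apply: (le_trans b2)]; rewrite ler_wpM2r ?edist_ge0.
- move=> x hx; apply: h3; rewrite /slab_out.
  have [?|?] := leP (x ord_max) (-1%:~R + 2^-1); first by left.
  right; rewrite leNgt; apply/negP => ?; apply: hx; rewrite /lastc; apply/andP; split; lra.
- move=> y; pose z : 'I_m.+1 -> int := fun i =>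
    if insub (val i) is Some j then y j else 0.
  have zy : rst z = y by apply: funext => i; rewrite /rst /z /= valK.
  have z0 : z ord_max = 0 by rewrite /z insubF //= ltnn.
  have := h2 z; rewrite z0 emb_rst // /q zy; apply.
  by [].
Qed.

(** * Lower bound for the members of [F_class] *)

Definition transpose {T : Type} (a b y : T) : T :=
  if `[< y = a >] then b else if `[< y = b >] then a else y.

Lemma transposel {T : Type} (a b : T) : transpose a b a = b.
Proof. by rewrite /transpose; case: asboolP. Qed.

Lemma transposer {T : Type} (a b : T) : transpose a b b = a.
Proof. by rewrite /transpose; case: asboolP => // _; case: asboolP. Qed.

Lemma transposeK {T : Type} (a b : T) : involutive (transpose a b).
Proof.
move=> y; have [->|ya] := pselect (y = a); first by rewrite transposel transposer.
have [->|yb] := pselect (y = b); first by rewrite transposer transposel.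
have e : transpose a b y = y by rewrite /transpose; do 2 case: asboolP => //.
by rewrite !e.
Qed.

(** The two exchanged points are opposite corners of one block, so the transposition respects all
    blocks. *)
Lemma F_class_swap {R : realType} {m : nat} (psi : R -> R) (S : nat) :
  F_class m.+1 psi -> (0 < S)%N ->
  exists Ups : pt R m.+1 -> pt R m.+1,
    [/\ bilip_on setT Ups (psi S%:R),
        forall x, ~ (- 2^-1 < lastc x < 2^-1) -> Ups x = x,
        Ups (@ext0 R m.+1 (emb (fun _ : 'I_m => 0))) =
          @ext0 R m.+1 (emb (fun _ : 'I_m => S%:Z - 1)) &
        Ups (@ext0 R m.+1 (emb (fun _ : 'I_m => S%:Z - 1))) =
          @ext0 R m.+1 (emb (fun _ : 'I_m => 0))].
Proof.
move=> [_ [_ hpsi]] S0; pose y0 : 'I_m -> int := fun _ => 0.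
pose y1 : 'I_m -> int := fun _ => S%:Z - 1.
have same z : block S z (emb y0 : pt R m) <-> block S z (emb y1 : pt R m).
  have arith (c : int) : (S%:Z * c <= 0 <= S%:Z * c + S%:Z - 1)
                       = (S%:Z * c <= S%:Z - 1 <= S%:Z * c + S%:Z - 1).
    by apply/idP/idP => /andP[h1 h2]; have c0 : c = 0 by [nia]; rewrite c0; lia.
  by split => /block_emb h; apply/block_emb => i; have := h i; rewrite /y0 /y1 arith.
have stable z y : block S z (emb y : pt R m) -> block S z (emb (transpose y0 y1 y) : pt R m).
  have [->|n0] := pselect (y = y0); first by rewrite transposel => /same.
  have [->|n1] := pselect (y = y1); first by rewrite transposer => /same.
  by rewrite /transpose; do 2 case: asboolP => //.
have [|z y' hy|Ups [U1 [U2 U3]]] := hpsi S (transpose y0 y1) S0 _ stable.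
- exact: inv_bij (transposeK y0 y1).
- by exists (transpose y0 y1 y'); split; [exact: stable|rewrite transposeK].
exists Ups; split => //.
  by have := U3 y0; rewrite transposel.
by have := U3 y1; rewrite transposer.
Qed.

Lemma F_class_lower {R : realType} {m : nat} (psi : R -> R) (S : nat) :
  (0 < m)%N -> F_class m.+1 psi -> (0 < S)%N -> 2 * S%:R - 1 <= psi S%:R.
Proof.
move=> m0 hpsi S0; have [|S1] := leqP S 1.
  move=> S1; have -> : S = 1%N by lia.
  by have [h _] := hpsi; have := h 1 (lexx 1); lra.
have [Ups [U1 U2 U3 U4]] := F_class_swap _ _ hpsi S0.
set L := psi _ in U1 *; pose n : R := S%:R - 1.
have n1 : 1 <= n.
  by rewrite /n lerBrDr -(natrD _ 1 1) ler_nat.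
have nE : (S%:Z - 1)%:~R = n :> R by rewrite intrB.
suff : 2 * n + 1 <= L by rewrite /n; lra.
case: m m0 hpsi Ups U1 U2 U3 U4 => [//|[|m]] _ hpsi Ups U1 U2 U3 U4.
  have p0 (c : int) : @ext0 R 2 (emb (fun _ : 'I_1 => c)) = pt2 c%:~R 0.
    apply: funext => i; case: (ord_max_or_widen i) => [->|[j ->]].
      by rewrite ext0_max.
    by rewrite ext0_widen /emb /pt2 (ord1 j).
  by apply: (planar_swap_bound L n Ups) => //; move: U3 U4; rewrite !p0 nE.
(* The fixed point [top] is at distance 1/2 from [O], so its distance to [P] is at most L/2. Hence
   L^2 >= 4(d - 1)n^2 + 1 >= 8n^2 + 1, which is at least (2n + 1)^2 as n >= 1. *)
pose O := @ext0 R m.+3 (emb (fun _ : 'I_m.+2 => 0)).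
pose P := @ext0 R m.+3 (emb (fun _ : 'I_m.+2 => S%:Z - 1)).
pose top : pt R m.+3 := upd O ord_max 2^-1.
have topE : Ups top = top by apply: U2; rewrite /= /top updk ltxx andbF.
have [h _] := bilip_onW U1 O top I I.
rewrite topE U3 -/P in h.
have dO : edist O top = 2^-1.
  rewrite (edist_last _ _ ord_max) => [|j jm]; last by rewrite /top updN.
  by rewrite /top updk /O ext0_max sub0r normrN ger0_norm // invr_ge0.
rewrite dO in h.
have L0 : 0 <= L by have := edist_ge0 P top; lra.
have eP : edist P top ^+ 2 = m.+2%:R * n ^+ 2 + 4^-1.
  rewrite /edist sqr_sqrtr; last by apply: sumr_ge0 => i _; exact: sqr_ge0.
  rewrite big_ord_recr /= /top updk /P ext0_max (eq_bigr (fun=> n ^+ 2)); last first.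
    move=> i _; rewrite updN; last by rewrite -(inj_eq val_inj) /= ltn_eqF.
    by rewrite /O !ext0_widen /emb nE sub0r sqrrN.
  rewrite sumr_const card_ord mulr_natl subr0; congr (_ + _).
  by field.
have m2 : 2 <= m.+2%:R :> R by rewrite ler_nat.
have := edist_ge0 P top; move: (edist P top) h eP => e h eP e0.
have : 2 * n ^+ 2 <= m.+2%:R * n ^+ 2 by rewrite ler_wpM2r // exprn_ge0 //; lra.
nra.
Qed.

(** A lower bound passes to the infimum because the class is nonempty, by [F_class_pow]. *)
Lemma beta_ge {R : realType} {m : nat} (t c : R) :
  (0 < m)%N -> (forall psi, F_class m.+1 psi -> c <= psi t) -> c <= beta m.+1 t.
Proof.
move=> m0 h; apply: lb_le_inf; last by move=> _ [psi hpsi <-]; exact: h.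
by exists (powR 2 (8 * m.+1%:R * t)), (fun t => powR 2 (8 * m.+1%:R * t)); first exact: F_class_pow.
Qed.

Lemma beta_le {R : realType} {m : nat} (t : R) (psi : R -> R) :
  1 <= t -> F_class m.+1 psi -> beta m.+1 t <= psi t.
Proof.
move=> t1 hpsi; apply: ge_inf; last by exists psi.
by exists 1 => _ [phi [h _] <-]; exact: h.
Qed.

Lemma beta_ge_floor {R : realType} {m : nat} (t : R) :
  (0 < m)%N -> 1 <= t -> (2 * Num.floor t - 1)%:~R <= beta m.+1 t.
Proof.
move=> m0 t1; apply: beta_ge => // psi hpsi.
have f1 : 1 <= Num.floor t by rewrite floor_ge_int.
have [S eS] : exists S : nat, Num.floor t = S%:Z by exists `|Num.floor t|%N; lia.
have S0 : (0 < S)%N by lia.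
have St : S%:R <= t by have := floor_le t; rewrite eS.
have S1 : 1 <= S%:R :> R by rewrite ler1n.
have [_ [mono _]] := hpsi.
rewrite eS intrB intrM; apply: le_trans (mono _ _ S1 St).
exact: (F_class_lower psi S m0 hpsi S0).
Qed.

(** From 2 floor(t) - 1 > 2t - 3 >= t. *)
Lemma beta_ge_id {R : realType} {m : nat} (t : R) :
  (0 < m)%N -> 3 <= t -> t <= beta m.+1 t.
Proof.
move=> m0 t3; have t1 : 1 <= t by lra.
apply: le_trans (beta_ge_floor t m0 t1).
have /andP[_] := floor_itv t; rewrite intrB intrM intrD; lra.
Qed.

(** With n = d, L = M1 M2 and Y = 2^12 n L^2 T^3, the left side is at most Y^(m+2). Moreover Y <= t
    <= beta(t) for the argument t of beta, and m + 2 <= 3^m + 1. *)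
Lemma beta_power_bound {R : realType} (m T D : nat) (M1 M2 : R) :
  let s := (2 * (M1 * M2 * Num.sqrt m.+1%:R))^-1 in
  (0 < m)%N -> (0 < T)%N -> 1 <= M1 -> 1 <= M2 -> D%:R <= 4 * (M1 * M2 * T%:R) ->
  M2 * (Num.sqrt m.+1%:R * (2 ^+ 15 * D%:R * T%:R ^+ 4 * (16 * D%:R) ^+ (2 * m) / s ^+ 2))
  <= beta m.+1 (2 ^+ 42 * powR m.+1%:R (9 / 2) * (M1 * M2) ^+ 10
                * powR T%:R (3 + 3 / m%:R)) ^+ (3 ^ m).+1.
Proof.
move=> s m0 T0 M1_ge1 M2_ge1 hD; set t := 2 ^+ 42 * _ * _ * _.
have L1 : 1 <= M1 * M2 by rewrite mulr_ege1.
have M2L : M2 <= M1 * M2 by rewrite ler_peMl //; lra.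
have T1 : 1 <= T%:R :> R by rewrite ler1n.
have n1 : 1 <= m.+1%:R :> R by rewrite ler1n.
set n : R := m.+1%:R in t n1 s *; set L := M1 * M2 in hD L1 M2L t s *.
have ge0 (x : R) : 1 <= x -> 0 <= x by lra.
pose Y := 2 ^+ 12 * n * L ^+ 2 * T%:R ^+ 3.
have powle (x y : R) k : 0 <= x -> x <= y -> x ^+ k <= y ^+ k.
  by move=> x0 xy; rewrite lerXn2r ?nnegrE // (le_trans x0).
have two1 : 1 <= 2 :> R by rewrite ler1n.
have pow1 k : 1 <= 2 ^+ k :> R by rewrite exprn_ege1 // ler1n.
have Y1 : 1 <= Y by rewrite /Y ?mulr_ege1 ?exprn_ege1.
have Yt : Y <= t.
  rewrite /Y /t; apply: ler_pM; rewrite ?mulr_ge0 ?exprn_ge0 ?ge0 //; last first.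
    rewrite -powR_mulrn ?ge0 // ler_powR //.
    by rewrite lerDl divr_ge0 ?ler0n.
  apply: ler_pM; rewrite ?mulr_ge0 ?exprn_ge0 ?ge0 //; last by rewrite ler_weXn2l.
  apply: ler_pM; rewrite ?exprn_ge0 ?ge0 //; first by rewrite ler_weXn2l // ler1n.
  by rewrite -[leLHS](powRr1 (ge0 _ n1)) ler_powR //; lra.
have t3 : 3 <= t.
  have c3 : 3 <= 2 ^+ 12 :> R.
    by apply: (@le_trans _ _ (2 ^+ 2)); [lra|exact: ler_weXn2l].
  apply: le_trans Yt; apply: (le_trans c3).
  have Z1 : 1 <= n * L ^+ 2 * T%:R ^+ 3 by rewrite ?mulr_ege1 ?exprn_ege1.
  have -> : Y = 2 ^+ 12 * (n * L ^+ 2 * T%:R ^+ 3).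
    by rewrite /Y; move: (2 ^+ 12) => p; ring.
  by rewrite ler_peMr // ge0.
clearbody t; have tb := beta_ge_id t m0 t3.
have Yb : Y <= beta m.+1 t by apply: le_trans tb.
apply: (@le_trans _ _ (Y ^+ m.+2)); last first.
  apply: (@le_trans _ _ (beta m.+1 t ^+ m.+2)).
    by rewrite lerXn2r ?nnegrE ?ge0 ?(le_trans Y1).
  by apply: ler_weXn2l; [exact: le_trans Yb|rewrite ltnS ltn_expl].
have sq : Num.sqrt n ^+ 2 = n by rewrite sqr_sqrtr ?ge0.
have sn : Num.sqrt n <= n.
  have := sqrtr_ge0 n; move: (Num.sqrt n) sq => r sq r0; nra.
have es : (s ^+ 2)^-1 = 2 ^+ 2 * L ^+ 2 * n.
  by rewrite /s exprVn invrK !exprMn sq mulrA.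
rewrite es.
have e1 : (16 * D%:R) ^+ (2 * m) <= (2 ^+ 12 * L ^+ 2 * T%:R ^+ 2) ^+ m.
  have D16 : 0 <= 16 * D%:R :> R by rewrite mulr_ge0.
  rewrite [leLHS]exprM; apply: (powle _ _); first exact: exprn_ge0.
  apply: (@le_trans _ _ ((16 * (4 * (L * T%:R))) ^+ 2)).
    by apply: (powle _ _) => //; rewrite ler_wpM2l.
  rewrite [leLHS](_ : _ = 2 ^+ 12 * L ^+ 2 * T%:R ^+ 2) //.
  ring.
have e2 : (2 ^+ 12 * L ^+ 2 * T%:R ^+ 2) ^+ m <= Y ^+ m.
  apply: (powle _ _); first by rewrite !mulr_ge0 ?exprn_ge0 ?ge0.
  rewrite /Y; apply: ler_pM; rewrite ?mulr_ge0 ?exprn_ge0 ?ge0 //; last by rewrite ler_weXn2l.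
  by rewrite ler_wpM2r ?exprn_ge0 ?ge0 // ler_peMr // exprn_ge0 ?ge0.
have [p15 p15E] : exists p : R, p = 2 ^+ 15 by eexists.
rewrite -p15E; set Z := (16 * D%:R) ^+ (2 * m) in e1 *.
have Z0 : 0 <= Z by rewrite exprn_ge0 ?mulr_ge0 ?ler0n.
have p150 : 0 <= p15 by rewrite p15E exprn_ge0.
(* Here M2 <= L, sqrt n <= n, D <= 4LT, and the power of 16D is at most Y^m. The remaining factor
   2^19 n^2 L^4 T^5 is below Y^2 = 2^24 n^2 L^4 T^6. *)
apply: (@le_trans _ _ (L * (n * (p15 * (4 * (L * T%:R)) * T%:R ^+ 4 * Y ^+ m * (2 ^+ 2 * L ^+ 2 * n))))).
  have ZY : Z <= Y ^+ m by apply: le_trans e2.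
  have T40 : 0 <= T%:R ^+ 4 :> R by rewrite exprn_ge0 ?ge0.
  have c0 : 0 <= 2 ^+ 2 * L ^+ 2 * n by rewrite !mulr_ge0 ?exprn_ge0 ?ge0.
  have a0 : 0 <= p15 * D%:R * T%:R ^+ 4 by rewrite mulr_ge0 // mulr_ge0.
  have b0 := mulr_ge0 (mulr_ge0 a0 Z0) c0.
  apply: ler_pM => //; [exact: ge0|by rewrite mulr_ge0 ?sqrtr_ge0|].
  apply: ler_pM => //; first exact: sqrtr_ge0.
  apply: ler_wpM2r => //; apply: ler_pM => //.
  by apply: ler_wpM2r => //; apply: ler_wpM2l.
have -> : Y ^+ m.+2 = Y ^+ 2 * Y ^+ m by rewrite -exprD.
rewrite (_ : L * _ = (p15 * 2 ^+ 4 * (n ^+ 2 * L ^+ 4)) * T%:R ^+ 5 * Y ^+ m); last first.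
  ring.
rewrite ler_wpM2r ?exprn_ge0 ?ge0 //.
have -> : Y ^+ 2 = 2 ^+ 24 * (n ^+ 2 * L ^+ 4) * T%:R ^+ 6.
  rewrite /Y; ring.
have nL0 : 0 <= n ^+ 2 * L ^+ 4 by rewrite mulr_ge0 ?exprn_ge0 ?ge0.
apply: ler_pM.
- by rewrite mulr_ge0 // mulr_ge0 // exprn_ge0.
- by rewrite exprn_ge0 // ge0.
- by apply: ler_wpM2r => //; rewrite p15E -exprD ler_weXn2l.
- by rewrite ler_weXn2l.
Qed.

Lemma lattice_extension_beta {R : realType} {m : nat} (f : ('I_m.+1 -> int) -> pt R m.+1)
    (T : nat) (G : pt R m.+1 -> pt R m.+1) (M1 M2 : R) :
  (0 < m)%N -> (0 < T)%N -> bilip_on setT G M2 ->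
  bilip_on (Ftilde_dom m.+1 T) (Ftilde f G) M1 ->
  (forall (k : int) (z : 'I_m.+1 -> int), slab m.+1 T k (emb z : pt R m.+1) ->
     exists x, slab m.+1 T k x /\ G x = f z) ->
  exists F : pt R m.+1 -> pt R m.+1, (forall z, F (emb z) = f z) /\
    bilip_on setT F (beta m.+1 (2 ^+ 42 * powR m.+1%:R (9 / 2) * (M1 * M2) ^+ 10
                * powR T%:R (3 + 3 / m%:R)) ^+ (3 ^ m).+1).
Proof.
move=> m0 T0 hG hF hS.
have M1_ge1 : 1 <= M1 by apply: bilip_lattice_const_ge1 hF => z; left; exists z.
have M2_ge1 : 1 <= M2 by apply: bilip_lattice_const_ge1 hG.
have L1 : 1 <= M1 * M2 by rewrite mulr_ege1.
have LT1 : 1 <= M1 * M2 * T%:R by rewrite mulr_ege1 // ler1n.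
(* Rounding up costs at most 1, and M1 M2 T >= 1, so D lies between 2 M1 M2 T and 4 M1 M2 T. *)
pose D := (Num.truncn (2 * (M1 * M2 * T%:R))).+1.
have LT0 : 0 <= 2 * (M1 * M2 * T%:R) by lra.
have /andP[D1 D2] := truncn_itv LT0.
have hD : 2 * (M1 * M2 * T%:R) <= D%:R by exact: ltW.
have hD' : D%:R <= 4 * (M1 * M2 * T%:R).
  by rewrite /D -natr1; lra.
have [F [Ff hFb]] := lattice_extension f T D G M1 M2 m0 T0 hD hG hF hS.
exists F; split => // x y Ax Ay xy; have [b1 b2] := hFb x y Ax Ay xy.
have c := beta_power_bound m T D M1 M2 m0 T0 M1_ge1 M2_ge1 hD'.
by split; [apply: (le_trans b1)|apply: (le_trans b2)]; apply: ler_wpM2r => //; exact: edist_ge0.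
Qed.

Theorem theorem1p2 (R : realType) (d : nat) (hd : (2 <= d)%N)
  (f : ('I_d -> int) -> pt R d) (hf : exists L : R, bilip_lat f L) :
  ( (exists F : pt R d -> pt R d,
        (exists L : R, bilip_on setT F L) /\ (forall z, F (emb z) = f z))
    <->
    (exists (T : nat) (G : pt R d -> pt R d),
        (1 <= T)%N /\
        (exists L : R, bilip_on setT G L) /\
        (exists L : R, bilip_on (Ftilde_dom d T) (Ftilde f G) L) /\
        (forall (k : int) (z : 'I_d -> int), slab (R:=R) d T k (emb z) ->
             exists x, slab d T k x /\ G x = f z)) )
  /\
  (forall s t : R, 1 <= s -> s <= t -> beta (R:=R) d s <= beta (R:=R) d t)
  /\
  (forall t : R, 1 <= t ->
      (2 * Num.floor t - 1)%:~R <= beta (R:=R) d t /\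
      beta (R:=R) d t <= powR 2 (8 * d%:R * t))
  /\
  (forall (T : nat) (G : pt R d -> pt R d) (M1 M2 : R),
      (1 <= T)%N ->
      bilip_on setT G M2 ->
      bilip_on (Ftilde_dom d T) (Ftilde f G) M1 ->
      (forall (k : int) (z : 'I_d -> int), slab (R:=R) d T k (emb z) ->
           exists x, slab d T k x /\ G x = f z) ->
      exists F : pt R d -> pt R d,
        (forall z, F (emb z) = f z) /\
        bilip_on setT F
          (beta (R:=R) d (2 ^+ 42 * powR d%:R (9 / 2) * (M1 * M2) ^+ 10
                     * powR T%:R (3 + 3 / (d.-1)%:R)) ^+ (3 ^ d.-1).+1)).
Proof.
case: d hd f hf => [//|[//|n]] _ f hf; set m := n.+1 in f hf *.
have m0 : (0 < m)%N by [].
split; [split|split; [|split]].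
(* From (i) to (ii), G = F and T = 1: then [Ftilde] coincides with F, and each lattice point is its
   own preimage in the slab. *)
- move=> [F [[L hL] Ff]]; exists 1%N, F; split => //; split; first by exists L.
  have FtE x : Ftilde f F x = F x.
    rewrite /Ftilde; case: asboolP => // -[z ->]; rewrite -Ff; congr F.
    by apply: funext => i; rewrite /emb intrKfloor.
  split; last by move=> k z hz; exists (emb z).
  by exists L => x y _ _ xy; rewrite !FtE; exact: hL.
- move=> [T [G [T0 [[M2 hG] [[M1 hF] hS]]]]].
  have [F [Ff hFb]] := lattice_extension_beta f T G M1 M2 m0 T0 hG hF hS.
  by exists F; split => //; eexists; exact: hFb.
- move=> s t s1 st; apply: beta_ge => // psi hpsi.
  have [_ [mono _]] := hpsi; apply: le_trans (mono _ _ s1 st).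
  exact: beta_le.
- move=> t t1; split; first exact: beta_ge_floor.
  exact: (beta_le t _ t1 (F_class_pow m0)).
- by move=> T G M1 M2 T0 hG hF hS; exact: (lattice_extension_beta f T G M1 M2 m0 T0 hG hF hS).
Qed.
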